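(* Let $G$ be a Lie group (in Milnor's sense, modeled over a Hausdorff locally convex vector space) that is $\infty$-continuous, $C^\infty$-semiregular, and constricted, and suppose that its Lie algebra $\mathfrak g$ is sequentially complete. Then for each open interval $I\subseteq\mathbb R$ and each $\mathfrak X:I\to\mathfrak g$ of class $C^1$, $$\partial_z\exp(\mathfrak X(x))=d_e\mathrm L_{\exp(\mathfrak X(x))}\Big(\frac{\mathrm{id}_{\mathfrak g}-\exp(-\mathrm{ad}\,\mathfrak X(x))}{\mathrm{ad}\,\mathfrak X(x)}\big(\partial_z\mathfrak X(x)\big)\Big)\qquad\text{for all }x\in I,$$ where $\partial_z$ denotes the derivative with respect to the parameter in $I$ (at $x$).
   Context: Calculus: for Hausdorff locally convex vector spaces $F,E$ and $U\subseteq F$ open, a map $f:U\to E$ is differentiable at $x$ if $D_vf(x)=\lim_{t\to 0}\frac1t(f(x+tv)-f(x))$ exists in $E$ for every $v\in F$; it is $C^0$ if continuous, $C^k$ ($k\ge 1$) if all iterated directional derivatives $D_{v_p}\cdots D_{v_1}f$ ($p\le k$) exist and $(x,v_1,\dots,v_p)\mapsto D_{v_p}\cdots D_{v_1}f(x)$ is continuous on $U\times F^p$ for $0\le p\le k$; $C^\infty$ (smooth) if $C^k$ for all $k$. $G$ is a Lie group in Milnor's sense: a group that is a smooth Hausdorff manifold (in this calculus) modeled on a Hausdorff locally convex vector space $E$, with smooth multiplication and inversion. $e$ is the unit, $\mathfrak g=T_eG$ the Lie algebra with bracket $[\cdot,\cdot]$, $\mathrm{ad}\,X(Y)=[X,Y]$,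 $\mathrm L_g(h)=gh$, $\mathrm R_g(h)=hg$. $\mathfrak P$ is the set of continuous seminorms on $E$. $\Xi:G\supseteq\mathcal U\to\mathcal V\subseteq E$ is a fixed chart with $e\in\mathcal U$, $\Xi(e)=0$, $\mathcal V$ convex. For $\mathfrak p\in\mathfrak P$ put $\dot{\mathfrak p}:=\mathfrak p\circ d_e\Xi$; these seminorms define the topology of $\mathfrak g$. A curve on $[r,r']$ ($r<r'$) is $C^k$ if it is the restriction of a $C^k$-curve on an open interval containing $[r,r']$. The $C^\infty$-topology on $C^\infty([r,r'],\mathfrak g)$ is generated by the seminorms $\dot{\mathfrak p}^s_\infty(\phi):=\sup\{\dot{\mathfrak p}(\phi^{(m)}(t)):0\le m\le s,\ t\in[r,r']\}$, $\mathfrak p\in\mathfrak P$, $s\in\mathbb N$. The right logarithmic derivative of $\mu\in C^1([r,r'],G)$ is $\delta^r(\mu)(t)=d_{\mu(t)}\mathrm R_{\mu(t)^{-1}}(\dot\mu(t))$. Put $\mathfrak D^\infty_{[r,r']}:=\delta^r(C^1([r,r'],G))\cap C^\infty([r,r'],\mathfrak g)$ and $\mathrm{evol}^\infty_{[r,r']}:\mathfrak D^\infty_{[r,r']}\to G$, $\delta^r(\mu)\mapsto\mu(r')\mu(r)^{-1}$ (well defined). $G$ is $C^\infty$-semiregular if $\mathfrak D^\infty_{[0,1]}=C^\infty([0,1],\mathfrak g)$; it is $\infty$-continuous if each $\mathrm{evol}^\infty_{[r,r']}$ is continuous in the subspace $C^\infty$-topology. The exponential map is $\exp(X):=\mathrm{evol}^\infty_{[0,1]}(\phi_X)$,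 with $\phi_X$ the constant curve $X$ on $[0,1]$. $G$ is constricted if for each bounded subset $\mathrm B\subseteq\mathfrak g$ and each $\mathfrak v\in\mathfrak P$ there exist $C\ge0$ and $\mathfrak w\in\mathfrak P$ with $\mathfrak v\le\mathfrak w$ such that $\dot{\mathfrak v}\circ\mathrm{ad}\,X_1\circ\dots\circ\mathrm{ad}\,X_n\le C^n\dot{\mathfrak w}$ for all $X_1,\dots,X_n\in\mathrm B$, $n\ge1$. For $X,Y\in\mathfrak g$, $\frac{\mathrm{id}_{\mathfrak g}-\exp(-\mathrm{ad}\,X)}{\mathrm{ad}\,X}(Y):=\sum_{n=0}^\infty\frac{1}{(n+1)!}(\mathrm{ad}(-X))^n(Y)=\int_0^1\Big(\sum_{n=0}^\infty\frac{s^n}{n!}(\mathrm{ad}(-X))^n(Y)\Big)ds$. *)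

(* Defs.v *)
From HB Require Import structures.
From mathcomp Require Import all_boot all_order all_algebra.
From mathcomp Require Import all_classical all_reals all_analysis.

Set Implicit Arguments.
Unset Strict Implicit.
Unset Printing Implicit Defensive.

Import Order.TTheory GRing.Theory Num.Theory.
Import numFieldNormedType.Exports.

Local Open Scope classical_set_scope.
Local Open Scope ring_scope.

(* The library's lim and cvg need a canonical point, which a tvsType does not
   have. *)
Section Limits.
Context {R : realType} {E : tvsType R}.

Definition convergent (A : set_system E) : Prop := exists l : E, A --> l.

Definition limit (A : set_system E) : E := xget 0 [set l : E | A --> l].

End Limits.

(* Calculus in locally convex spaces.  The library's derivatives are restricted
   to normed modules, so directional derivatives are defined here over tvsType,
   the library's locally convex topological vector spaces.  Maps defined on an
   open set U are total functions, of which only the values on U matter. *)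
Section Calculus.
Context {R : realType} {F E : tvsType R}.

Definition dquot (f : F -> E) (x v : F) (t : R) : E :=
  t^-1 *: (f (x + t *: v) - f x).

Definition dir_derivable (f : F -> E) (x v : F) : Prop :=
  convergent (dquot f x v t @[t --> (0 : R)^']).

Definition dir_derive (f : F -> E) (x v : F) : E :=
  limit (dquot f x v t @[t --> (0 : R)^']).

(* iter_derive f [:: v_1; ...; v_p] = D_{v_p} ... D_{v_1} f *)
Fixpoint iter_derive (f : F -> E) (vs : seq F) : F -> E :=
  if vs is v :: vs' then iter_derive (fun x => dir_derive f x v) vs' else f.

(* F^p is represented by the row vectors 'rV[F]_p with their product topology. *)
Definition Ck (k : nat) (U : set F) (f : F -> E) : Prop :=
  (forall (vs : seq F) (v x : F),
     (size vs < k)%N -> U x -> dir_derivable (iter_derive f vs) x v) /\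
  (forall p : nat, (p <= k)%N ->
     {within U `*` [set: 'rV[F]_p], continuous
        (fun z : F * 'rV[F]_p =>
           iter_derive f [seq z.2 ord0 i | i <- enum 'I_p] z.1)}).

Definition Cinfty (U : set F) (f : F -> E) : Prop := forall k, Ck k U f.

End Calculus.

Section LocallyConvex.
Context {R : realType} (E : tvsType R).

Definition continuous_seminorm (p : E -> R) : Prop :=
  [/\ forall x y, p (x + y) <= p x + p y,
      forall (a : R) x, p (a *: x) = `|a| * p x
    & continuous (p : E -> R^o)].

Definition vn_bounded (B : set E) : Prop :=
  forall U : set E, nbhs (0 : E) U ->
    exists2 r : R, 0 < r & B `<=` [set r *: x | x in U].

(* Cauchy sequences are those of the additive group E: the class tvsType does
   not force the uniformity carried by E to be translation invariant, so the
   library's cauchy filters are not the right notion. *)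
Definition sequentially_complete : Prop :=
  forall u : nat -> E,
    (forall U : set E, nbhs (0 : E) U ->
       exists N : nat, forall m n : nat,
         (N <= m)%N -> (N <= n)%N -> U (u m - u n)) ->
    convergent (u @ \oo).

End LocallyConvex.

(* A chart is a homeomorphism from the open set cdom onto the open set ccod,
   with total functions cmap and cinv in both directions. *)
Record chart {R : realType} (E : tvsType R) (G : topologicalType) := Chart {
  cdom : set G;
  ccod : set E;
  cmap : G -> E;
  cinv : E -> G;
  cdom_open : open cdom;
  ccod_open : open ccod;
  cmap_cod : forall g, cdom g -> ccod (cmap g);
  cinv_dom : forall u, ccod u -> cdom (cinv u);
  cmapK : forall g, cdom g -> cinv (cmap g) = g;
  cinvK : forall u, ccod u -> cmap (cinv u) = u;
  cmap_continuous : {within cdom, continuous cmap};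
  cinv_continuous : {within ccod, continuous cinv} }.

Definition smooth_transition {R : realType} {E : tvsType R}
    {G : topologicalType} (c c' : chart E G) : Prop :=
  Cinfty [set u | ccod c u /\ cdom c' (cinv c u)]
         (fun u => cmap c' (cinv c u)).

(* The smooth structure is a maximal atlas. *)
HB.mixin Record isMilnorLie (R : realType) (E : tvsType R) G
    of Topological G & Group G := {
  lie_hausdorff : hausdorff_space G;
  atlas : set (chart E G);
  atlas_cover : forall g : G, exists c, atlas c /\ cdom c g;
  atlas_smooth : forall c c', atlas c -> atlas c' -> smooth_transition c c';
  atlas_maximal : forall c,
    (forall c', atlas c' -> smooth_transition c c' /\ smooth_transition c' c) ->
    atlas c;
  lie_mul_continuous : continuous (fun z : G * G => (z.1 * z.2)%g);
  lie_inv_continuous : continuous (fun g : G => g^-1%g);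
  lie_mul_smooth : forall c1 c2 c3, atlas c1 -> atlas c2 -> atlas c3 ->
    Cinfty
      [set z : E * E | [/\ ccod c1 z.1, ccod c2 z.2
                         & cdom c3 (cinv c1 z.1 * cinv c2 z.2)%g]]
      (fun z : E * E => cmap c3 (cinv c1 z.1 * cinv c2 z.2)%g);
  lie_inv_smooth : forall c1 c2, atlas c1 -> atlas c2 ->
    Cinfty [set u : E | ccod c1 u /\ cdom c2 (cinv c1 u)^-1%g]
           (fun u : E => cmap c2 (cinv c1 u)^-1%g) }.

#[short(type="milnorLieType")]
HB.structure Definition MilnorLie (R : realType) (E : tvsType R) :=
  {G of isMilnorLie R E G & Topological G & Group G}.

Section Tangent.
Context {R : realType} {E : tvsType R} {G : milnorLieType E}.

(* An arbitrary chart of the atlas around g. *)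
Definition chart_at (g : G) : chart E G := projT1 (cid (atlas_cover g)).

(* The tangent space at g, in the trivialization given by chart_at g: the
   element v : E stands for the tangent vector at g whose principal part in
   chart_at g is v.  T_g G thus receives the linear structure and the topology
   transported from E along the differential of the chart. *)
Definition tangent (g : G) : tvsType R := E.

Definition tmap (f : G -> G) (g : G) (X : tangent g) : tangent (f g) :=
  dir_derive (fun u : E => cmap (chart_at (f g)) (f (cinv (chart_at g) u)))
    (cmap (chart_at g) g) X.

Definition differential {V : tvsType R} (f : G -> V) (g : G) (X : tangent g) :
    V :=
  dir_derive (fun u : E => f (cinv (chart_at g) u)) (cmap (chart_at g) g) X.

Definition has_velocity (mu : R -> G) (t : R) (w : tangent (mu t)) : Prop :=
  (\forall s \near t, cdom (chart_at (mu t)) (mu s)) /\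
  dquot (fun s : R^o => cmap (chart_at (mu t)) (mu s)) t 1 h @[h --> (0 : R)^']
    --> (w : E).

Definition velocity (mu : R -> G) (t : R) : tangent (mu t) :=
  dir_derive (fun s : R^o => cmap (chart_at (mu t)) (mu s)) t 1.

(* C^k-curves in G on an open set J of R. *)
Definition lie_Ck (k : nat) (J : set R) (mu : R -> G) : Prop :=
  {within J, continuous mu} /\
  forall c, atlas c ->
    Ck k (J `&` mu @^-1` cdom c : set R^o) (fun s : R^o => cmap c (mu s)).

End Tangent.
Arguments has_velocity {R E G} mu t w.

Section LieAlgebra.
Context {R : realType} {E : tvsType R}.

Definition lie_algebra (G : milnorLieType E) : tvsType R := tangent (1%g : G).

Context {G : milnorLieType E}.
Notation g := (lie_algebra G).

Definition Ad (h : G) (Y : g) : g :=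
  tmap (fun k : G => (h * k * h^-1)%g) (Y : tangent (1%g : G)).

(* [X, Y] = d_e(h |-> Ad_h(Y))(X), i.e. the bracket of left-invariant vector
   fields. *)
Definition bracket (X Y : g) : g := differential (Ad^~ Y) (X : tangent 1%g).

(* sum_n (ad(-X))^n(Y) / (n+1)!; the sequence of its partial sums comes first *)
Definition ad_series (X Y : g) : nat -> g :=
  series (fun n => (n.+1`!%:R)^-1 *: iter n (bracket (- X)) Y).

Definition ad_sum (X Y : g) : g := limit (ad_series X Y @ \oo).

(* the seminorm p \o d_e Xi on the Lie algebra *)
Definition dotp (Xi : chart E G) (p : E -> R) (X : g) : R :=
  p (differential (cmap Xi) (X : tangent 1%g)).

Definition constricted (Xi : chart E G) : Prop :=
  forall (B : set g), vn_bounded B ->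
  forall v : E -> R, continuous_seminorm v ->
  exists (C : R) (w : E -> R),
    [/\ 0 <= C, continuous_seminorm w, (forall u, v u <= w u)
      & forall Xs : seq g, (0 < size Xs)%N -> (forall X, X \in Xs -> B X) ->
        forall Y : g,
          dotp Xi v (foldr bracket Y Xs) <= C ^+ size Xs * dotp Xi w Y].

End LieAlgebra.

Section Evolution.
Context {R : realType} {E : tvsType R} {G : milnorLieType E}.
Notation g := (lie_algebra G).

(* A C^k-curve on [r, r'] is the restriction of a C^k-curve on an open interval
   containing [r, r'].  It is represented here by such an extension, a total
   function on R; every notion below only depends on its values on [r, r']
   (derivatives at the end points are determined by continuity). *)
Definition smooth_on (r r' : R) (phi : R -> g) : Prop :=
  exists a b : R, [/\ a < r, r' < b & Cinfty (`]a, b[ : set R^o) phi].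

Definition lie_C1_on (r r' : R) (mu : R -> G) : Prop :=
  exists a b : R, [/\ a < r, r' < b & lie_Ck 1 `]a, b[ mu].

Definition curve_derive (phi : R -> g) (t : R) : g :=
  dir_derive (phi : R^o -> g) t 1.

(* the seminorm sup {dotp p (phi^(m)(t)) | m <= s, t in [r, r']} *)
Definition Cinfty_seminorm (Xi : chart E G) (p : E -> R) (s : nat) (r r' : R)
    (phi : R -> g) : R :=
  sup [set a : R | exists (m : nat) (t : R),
    [/\ (m <= s)%N, r <= t <= r' & a = dotp Xi p (iter m curve_derive phi t)]].

(* Neighborhoods of phi in the C^infty-topology.  The family of seminorms is
   directed, so that the balls of a single seminorm form a base. *)
Definition Cinfty_nbhs (Xi : chart E G) (r r' : R) (phi : R -> g) :
    set_system (R -> g) :=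
  filter_from
    [set i : (E -> R) * nat * R | continuous_seminorm i.1.1 /\ 0 < i.2]
    (fun i => [set psi | Cinfty_seminorm Xi i.1.1 i.1.2 r r'
                           (fun t => psi t - phi t) < i.2]).

(* the right logarithmic derivative; since h * h^-1 is the unit, the value lies
   in the tangent space at the unit *)
Definition rlog_derive (mu : R -> G) (t : R) : g :=
  tmap (fun h : G => (h * (mu t)^-1)%g) (velocity mu t).

Definition rlog_on (r r' : R) (mu : R -> G) (phi : R -> g) : Prop :=
  lie_C1_on r r' mu /\ forall t, r <= t <= r' -> rlog_derive mu t = phi t.

Definition Dinfty (r r' : R) : set (R -> g) :=
  [set phi | smooth_on r r' phi /\ exists mu, rlog_on r r' mu phi].

Definition evol (r r' : R) (phi : R -> g) : G :=
  xget 1%g [set h | exists2 mu, rlog_on r r' mu phi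
                              & h = (mu r' * (mu r)^-1)%g].

Definition lie_exp (X : g) : G := evol 0 1 (fun=> X).

End Evolution.

Definition semiregular {R : realType} {E : tvsType R} (G : milnorLieType E) :
    Prop :=
  Dinfty 0 1 = [set phi : R -> lie_algebra G | smooth_on 0 1 phi].

Definition infty_continuous {R : realType} {E : tvsType R}
    {G : milnorLieType E} (Xi : chart E G) : Prop :=
  forall r r' : R, r < r' ->
  forall phi : R -> lie_algebra G, Dinfty r r' phi ->
    evol r r' @ within (Dinfty r r') (Cinfty_nbhs Xi r r' phi)
      --> evol r r' phi.

(* Main.v *)
Require Import Defs.
From HB Require Import structures.
From mathcomp Require Import all_boot all_order all_algebra.
From mathcomp Require Import all_classical all_reals all_analysis.
From mathcomp Require Import lra ring.

Set Implicit Arguments.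
Unset Strict Implicit.
Unset Printing Implicit Defensive.

Import Order.TTheory GRing.Theory Num.Theory.
Import numFieldNormedType.Exports.

Local Open Scope classical_set_scope.
Local Open Scope ring_scope.

(** Write X and X' for the value of the given curve and its derivative at x, and
    X_z for its value at z.  By semiregularity there is a curve nu_z with
    nu_z(0) = 1 and constant right logarithmic derivative X_z, so that
    nu_z(1) = exp(X_z) (exp_curve).  The ratio
    al_z(t) = nu_x(t)^-1 nu_z(t) starts at the unit and satisfies
    exp(X)^-1 exp(X_z) = al_z(1); its right logarithmic derivative is
    Ad(nu_x(t)^-1)(X_z - X) (rvel_div).  The claim is therefore that the curve
    z |-> al_z(1) has at x the velocity sum_n (ad(-X))^n(X') / (n+1)!.

    Let u0 be the coordinate of the unit in a chart, m the multiplication in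
    this chart and om(w, V) = D_(V,0) m(u0, w).  As long as al_z(t) stays in the
    chart, its coordinate w_z(t) satisfies
    w_z'(t) = om(w_z(t), Ad(nu_x(t)^-1)(X_z - X)).
    Since om(u0, V) = V, the quotient (w_z(1) - u0) / (z - x) tends to the
    integral of Ad(nu_x(t)^-1)(X') over [0, 1], provided that al_z(t) tends to
    the unit uniformly in t.  Three ingredients make this precise.

    - Uniformity (uniform_evolution).  The point al_z(tau) is the evolution on
      [0, 1] of the rescaled curve t |-> tau Ad(nu_x(tau t)^-1)(X_z - X).  The
      m-th derivative of this curve is
      tau^(m+1) Ad(nu_x(tau t)^-1)((ad(-X))^m(X_z - X)) (Adc_deriv), so that,
      by constrictedness, its C^infty-seminorms are bounded by a seminorm of
      X_z - X that does not depend on tau.  Continuity of the evolution at the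
      zero curve then applies to all tau at once.

    - The series (Adc_taylor, adN_bound).  Taylor's formula with remainder gives
      Ad(nu_x(t)^-1)(X') = sum_n t^n / n! (ad(-X))^n(X'), uniformly on [0, 1];
      constrictedness bounds the remainder by a multiple of C^N / N!.  The
      integrated series converges by sequential completeness (ad_series_cvg).

    - The passage to the limit (hasvel_exp_ratio).  No integral is formed: the
      difference quotient of the coordinates is compared with the N-th partial
      sum through the mean value inequality for seminorms (mean_value). *)

(** * Preliminaries on limits *)

Lemma cvg_ext {T : Type} {U : nbhsType} (F : set_system T) (f g : T -> U)
  (A : set_system U) : f =1 g -> f @ F --> A -> g @ F --> A.
Proof. by move=> /funext ->. Qed.

Lemma cvg_at {T : Type} {U V : topologicalType} (F : set_system T)
    (g : U -> V) (f : T -> U) (l : U) :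
  {for l, continuous g} -> f @ F --> l -> g (f x) @[x --> F] --> g l.
Proof. by move=> gl fl; exact: (cvg_comp _ _ fl gl). Qed.

Lemma hausdorff_prod {T U : topologicalType} : hausdorff_space T ->
  hausdorff_space U -> hausdorff_space (T * U)%type.
Proof.
move=> hT hU [a b] [c d] h; congr pair.
  apply: hT => A B Aa Bc.
  have [||[t u] [[/= At _] [/= Bt _]]] := h (A `*` setT) (B `*` setT).
  - by exists (A, setT) => //; split => //=; exact: filterT.
  - by exists (B, setT) => //; split => //=; exact: filterT.
  by exists t.
apply: hU => A B Ab Bd.
have [||[t u] [[/= _ Au] [/= _ Bu]]] := h (setT `*` A) (setT `*` B).
- by exists (setT, A) => //; split => //=; exact: filterT.
- by exists (setT, B) => //; split => //=; exact: filterT.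
by exists u.
Qed.

Lemma near_fst {T U : topologicalType} (P : T -> Prop) (x : T) (v : U) :
  (\forall y \near x, P y) -> \forall z \near (x, v), P z.1.
Proof. by move=> hP; exact: (@cvg_fst _ _ (nbhs x) (nbhs v) _ _ hP). Qed.

Lemma within_nbhs_continuous {T U : topologicalType} (A : set T) (f : T -> U) (x : T) :
  nbhs x A -> {within A, continuous f} -> {for x, continuous f}.
Proof.
move=> Ax /subspace_continuousP/(_ x (nbhs_singleton Ax)).
by rewrite within_interior.
Qed.

(** The tube lemma for the compact interval [0, 1]. *)
Lemma near_itv01 {R : realType} T (F : set_system T) {FF : Filter F} (P : T -> R -> Prop) :
  (forall t : R, 0 <= t <= 1 -> \forall t' \near t & i \near F, P i t') ->
  \forall i \near F, forall t : R, 0 <= t <= 1 -> P i t.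
Proof.
move=> h; have := @segment_compact R 0 1; rewrite compact_near_coveringP.
move=> /(_ T F P FF) hK.
have {hK} : \forall i \near F, `[0, 1]%classic `<=` P i.
  by apply: hK => t; rewrite /= in_itv /=; exact: h.
by apply: filterS => i hi t t01; apply: hi; rewrite /= in_itv.
Qed.

(** * Continuous seminorms of a locally convex space *)

Section Seminorms.
Context {R : realType} {E : tvsType R}.
Implicit Types (p q : E -> R) (x y : E).

Lemma seminorm_triangle p x y : continuous_seminorm p -> p (x + y) <= p x + p y.
Proof. by case=> + _ _; exact. Qed.

Lemma seminormZ p (a : R) x : continuous_seminorm p -> p (a *: x) = `|a| * p x.
Proof. by case=> _ + _; exact. Qed.

Lemma seminorm0 p : continuous_seminorm p -> p 0 = 0.
Proof. by move=> hp; rewrite -(scale0r (0 : E)) seminormZ// normr0 mul0r. Qed.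

Lemma seminormN p x : continuous_seminorm p -> p (- x) = p x.
Proof. by move=> hp; rewrite -scaleN1r seminormZ// normrN1 mul1r. Qed.

Lemma seminorm_ge0 p x : continuous_seminorm p -> 0 <= p x.
Proof.
move=> hp; have := seminorm_triangle x (- x) hp.
by rewrite subrr seminorm0// seminormN// -mulr2n pmulrn_lge0.
Qed.

Lemma seminormB p x y : continuous_seminorm p -> p (x - y) = p (y - x).
Proof. by move=> hp; rewrite -seminormN// opprB. Qed.

Lemma seminorm_le_sub p x y : continuous_seminorm p -> p x <= p (x - y) + p y.
Proof. by move=> hp; rewrite -{1}(subrK y x) seminorm_triangle. Qed.

Lemma convex_comb (A : set E) x y (t : R) : convex_set A ->
  0 <= t -> t <= 1 -> A x -> A y -> A (t *: x + (1 - t) *: y).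
Proof.
move=> cA t0 t1 Ax Ay.
have := cA x y (Itv01 t0 t1); rewrite !inE => /(_ Ax Ay).
by [].
Qed.

Lemma tvs_cvgD T (F : set_system T) {FF : Filter F} (f g : T -> E) (a b : E) :
  f @ F --> a -> g @ F --> b -> f x + g x @[x --> F] --> a + b.
Proof.
move=> fa gb; exact: (cvg_comp _ _ (cvg_pair fa gb) (@add_continuous E (a, b))).
Qed.

Lemma tvs_cvgZ T (F : set_system T) {FF : Filter F} (k : T -> R) (f : T -> E)
    (c : R) (a : E) :
  k @ F --> c -> f @ F --> a -> k x *: f x @[x --> F] --> c *: a.
Proof.
move=> kc fa.
have kc' : (k : T -> R^o) @ F --> (c : R^o) by [].
exact: (cvg_comp _ _ (cvg_pair kc' fa) (@scale_continuous _ E (c, a))).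
Qed.

Lemma tvs_cvgN T (F : set_system T) {FF : Filter F} (f : T -> E) (a : E) :
  f @ F --> a -> - f x @[x --> F] --> - a.
Proof.
move=> fa; rewrite -scaleN1r.
under eq_fun do rewrite -scaleN1r.
by apply: tvs_cvgZ => //; exact: cvg_cst.
Qed.

Lemma tvs_cvgB T (F : set_system T) {FF : Filter F} (f g : T -> E) (a b : E) :
  f @ F --> a -> g @ F --> b -> f x - g x @[x --> F] --> a - b.
Proof. by move=> fa gb; apply: tvs_cvgD => //; exact: tvs_cvgN. Qed.

Lemma bounded_set1 (X : E) : vn_bounded [set X].
Proof.
move=> U U0; have : k *: X @[k --> (0 : R)] --> (0 : R) *: X.
  by apply: tvs_cvgZ; [exact: cvg_id|exact: cvg_cst].
rewrite scale0r => /(_ U U0) /nbhs_ballP[d /= d0 hd].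
exists (d / 2)^-1; first by rewrite invr_gt0 divr_gt0.
move=> _ ->; exists ((d / 2) *: X).
  apply: hd; rewrite /ball /= sub0r normrN gtr0_norm ?divr_gt0//.
  by rewrite ltr_pdivrMr// ltr_pMr// ltr1n.
by rewrite scalerA mulVf ?scale1r// gt_eqF// divr_gt0.
Qed.

(** The Minkowski functional of V. *)
Definition gauge (V : set E) x : R := inf [set r | 0 < r /\ V (r^-1 *: x)].

Section Gauge.
Variable V : set E.
Hypotheses (V0 : nbhs 0 V) (cV : convex_set V) (sV : forall x, V x -> V (- x)).

Let S x := [set r : R | 0 < r /\ V (r^-1 *: x)].

Let S_nonempty x : S x !=set0.
Proof.
have : nbhs (0 : R) [set k | V (k *: x)].
  have : k *: x @[k --> (0 : R)] --> (0 : R) *: x.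
    by apply: tvs_cvgZ; [exact: cvg_id|exact: cvg_cst].
  by rewrite scale0r => /(_ V V0).
move=> /nbhs_ballP[e /= e0 eV].
exists (e / 2)^-1; split; first by rewrite invr_gt0 divr_gt0.
rewrite invrK; apply: eV; rewrite /ball /= sub0r normrN gtr0_norm ?divr_gt0//.
by rewrite ltr_pdivrMr// ltr_pMr// ltr1n.
Qed.

Let S_inf x : has_inf (S x).
Proof. by split; [exact: S_nonempty|exists 0 => r [/ltW]]. Qed.

Let gauge_le x r : 0 < r -> V (r^-1 *: x) -> gauge V x <= r.
Proof. by move=> r0 Vr; apply: ge_inf; [exact: (S_inf x).2|]. Qed.

Let gauge_ex x r : gauge V x < r -> exists2 s, s < r & 0 < s /\ V (s^-1 *: x).
Proof.
move=> h.
have e0 : 0 < r - gauge V x by rewrite subr_gt0.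
have [s Ss sr] := inf_adherent e0 (S_inf x).
by exists s => //; rewrite addrCA subrr addr0 in sr.
Qed.

Lemma gauge_lt1 x : gauge V x < 1 -> V x.
Proof.
move=> /gauge_ex[s s1 [s0 Vs]].
have := convex_comb cV (ltW s0) (ltW s1) Vs (nbhs_singleton V0).
by rewrite scaler0 addr0 scalerA divff ?scale1r// gt_eqF.
Qed.

Lemma gauge_seminorm : continuous_seminorm (gauge V).
Proof.
have gD x y : gauge V (x + y) <= gauge V x + gauge V y.
  apply/ler_addgt0Pr => e e0.
  have e2 : 0 < e / 2 by rewrite divr_gt0.
  have [|s sx [s0 Vs]] := @gauge_ex x (gauge V x + e / 2); first by rewrite ltrDl.
  have [|r rx [r0 Vr]] := @gauge_ex y (gauge V y + e / 2); first by rewrite ltrDl.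
  have sr0 : 0 < s + r by rewrite addr_gt0.
  apply: (@le_trans _ _ (s + r)); last by lra.
  apply: gauge_le => //.
  have := @convex_comb _ _ _ (s / (s + r)) cV _ _ Vs Vr.
  rewrite divr_ge0 ?(ltW s0) ?(ltW sr0)// ler_pdivrMr// mul1r lerDl ltW//.
  move=> /(_ isT isT).
  have -> : 1 - s / (s + r) = r / (s + r).
    by rewrite -[X in X - _](@divff _ (s + r)) ?gt_eqF// -mulrBl addrAC subrr add0r.
  rewrite !scalerA mulrAC divff ?gt_eqF// mul1r mulrAC divff ?gt_eqF// mul1r.
  by rewrite -scalerDr.
have g0 x : 0 <= gauge V x.
  by apply: lb_le_inf; [exact: S_nonempty|move=> r [/ltW]].
have gZ_le a x : gauge V (a *: x) <= `|a| * gauge V x.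
  have [->|a0] := eqVneq a 0.
    rewrite scale0r normr0 mul0r; apply/ler_addgt0Pr => e e0; rewrite add0r.
    by apply: gauge_le => //; rewrite scaler0; exact: nbhs_singleton.
  have na0 : 0 < `|a| by rewrite normr_gt0.
  rewrite mulrC -ler_pdivrMr//; apply: lb_le_inf; [exact: S_nonempty|move=> r [r0 Vr]].
  rewrite ler_pdivrMr//; apply: gauge_le; first by rewrite mulr_gt0.
  rewrite scalerA invfM -mulrA [_^-1 * a]mulrC.
  have [ap|ap] := ltP 0 a; first by rewrite gtr0_norm// divff// mulr1.
  by rewrite ler0_norm// invrN mulrN divff// mulrN1 scaleNr; exact: sV.
have gZ a x : gauge V (a *: x) = `|a| * gauge V x.
  apply/eqP; rewrite eq_le gZ_le/=; have [->|a0] := eqVneq a 0.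
    by rewrite normr0 mul0r g0.
  have := gZ_le a^-1 (a *: x); rewrite scalerA mulVf// scale1r normfV.
  by rewrite ler_pdivlMl ?normr_gt0.
split=> // x.
apply/cvgrPdist_le => e e0 /=.
have : nbhs x [set x + z | z in [set e *: z | z in V]].
  by apply/nbhsT/nbhs0Z => //; rewrite gt_eqF.
apply: filterS => _ [_ [z Vz <-] <-].
have ge : gauge V (e *: z) <= e.
  by apply: gauge_le => //; rewrite scalerA mulVf ?scale1r// gt_eqF.
have h1 := gD x (e *: z).
have := gD (x + e *: z) (- (e *: z)).
rewrite addrK -(scaleN1r (e *: z)) gZ normrN1 mul1r => h2.
by rewrite ler_norml; apply/andP; split; lra.
Qed.
End Gauge.

(** Local convexity enters here: the Minkowski functional of b `&` - b, for a
    convex open b inside U, is such a seminorm. *)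
Lemma seminorm_nbhs (U : set E) : nbhs 0 U ->
  exists2 p, continuous_seminorm p & forall x, p x < 1 -> U x.
Proof.
move=> U0; have [B cB [Bo Bb]] := @locally_convex R E.
have [b [Bb' b0] bU] := Bb 0 U U0.
have cb : convex_set b by apply: cB; rewrite inE.
have nb : nbhs 0 b by apply: open_nbhs_nbhs; split => //; exact: Bo.
pose V := b `&` [set x | b (- x)].
have V0 : nbhs 0 V.
  apply: filterI => //; have := nbhs0N nb; apply: filterS => _ [z bz <-] /=.
  by rewrite opprK.
have cV : convex_set V.
  move=> x y l; rewrite !inE => -[bx bx'] [by' by''].
  have l0 : 0 <= l%:num by [].
  have l1 : l%:num <= 1 by [].
  split; first exact: (convex_comb cb l0 l1 bx by').
  have := convex_comb cb l0 l1 bx' by''.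
  by rewrite !scalerN -opprD.
have sV x : V x -> V (- x) by move=> [? ?]; split => //=; rewrite opprK.
exists (gauge V); first exact: gauge_seminorm.
by move=> x /(gauge_lt1 V0 cV)[bx _]; exact: bU.
Qed.
End Seminorms.

Section SeminormLimits.
Context {R : realType} {E : tvsType R}.

Lemma seminorm_cvgP T (F : set_system T) {FF : Filter F} (f : T -> E) (l : E) :
  f @ F --> l <->
  forall p, continuous_seminorm p -> forall e, 0 < e ->
    \forall x \near F, p (f x - l) < e.
Proof.
split=> [fl p hp e e0|h U Ul].
  have h : f x - l @[x --> F] --> l - l by apply: tvs_cvgB => //; exact: cvg_cst.
  rewrite subrr in h.
  have [_ _ /(_ 0) pc] := hp.
  have := cvg_comp _ _ h pc.
  rewrite seminorm0// => /cvgr_lt; exact.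
have U0 : nbhs 0 [set x | U (l + x)].
  have : nbhs (- l + l) [set - l + z | z in U] by exact: nbhsB.
  rewrite addNr; apply: filterS => _ [z Uz <-] /=.
  by rewrite addrA subrr add0r.
have [p hp pU] := seminorm_nbhs U0.
have := h p hp 1 ltr01; apply: filterS => x /pU /=.
by rewrite addrC subrK.
Qed.

Lemma continuous_seminorm_cvg T (F : set_system T) {FF : Filter F}
    (f : T -> E) (l : E) (p : E -> R) :
  continuous_seminorm p -> f @ F --> l -> p (f x) @[x --> F] --> p l.
Proof. by move=> [_ _ pc] fl; exact: (cvg_comp _ _ fl (pc l)). Qed.

Lemma seminorm_separates (hE : hausdorff_space E) (x : E) :
  (forall p, continuous_seminorm p -> p x = 0) -> x = 0.
Proof.
move=> h; apply: hE => A B Ax B0.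
have [p hp pB] : exists2 p, continuous_seminorm p & forall y, p (y - x) < 1 -> A y.
  have : nbhs (- x + x) [set - x + z | z in A] by exact: nbhsB.
  rewrite addNr => /seminorm_nbhs[p hp pA]; exists p => // y /pA[z Az].
  by rewrite addrC => /addIr <-.
exists 0; split; last exact: nbhs_singleton.
by apply: pB; rewrite sub0r seminormN// h.
Qed.

Lemma seminorm_sum (p : E -> R) (u : nat -> E) (m n : nat) : continuous_seminorm p ->
  p (\sum_(m <= i < n) u i) <= \sum_(m <= i < n) p (u i).
Proof.
move=> hp; elim/big_ind2: _ => [|x1 x2 y1 y2 h1 h2|//]; first by rewrite seminorm0.
by apply: (le_trans (seminorm_triangle _ _ hp)); exact: lerD.
Qed.

End SeminormLimits.

(** * Derivatives of curves and the mean value inequality *)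

Definition has_deriv {R : realType} {F E : tvsType R} (f : F -> E) (x v : F)
  (l : E) : Prop := dquot f x v t @[t --> (0 : R)^'] --> l.

(** The derivative of a curve, freed from the scaling of 1 : R^o which [dquot]
    involves; both forms agree by [curve_derivE]. *)
Definition curve_deriv {R : realType} {E : tvsType R} (f : R -> E) (t : R) (l : E) :
  Prop := h^-1 *: (f (t + h) - f t) @[h --> (0 : R)^'] --> l.

Section MeanValue.
Context {R : realType} {E : tvsType R}.

Lemma curve_derivE (f : R -> E) (t : R) (l : E) :
  curve_deriv f t l = has_deriv (f : R^o -> E) t 1 l.
Proof.
rewrite /curve_deriv /has_deriv /dquot.
by under eq_fun do rewrite -[X in t + X]mulr1.
Qed.

Lemma cvg_dnbhs0 : (h : R) @[h --> (0 : R)^'] --> (0 : R).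
Proof. exact: nbhs_dnbhs. Qed.

Lemma near_dnbhs0P (Q : R -> Prop) :
  (\forall h \near (0 : R)^', Q h) <->
  exists2 d : R, 0 < d & forall h, `|h| < d -> h != 0 -> Q h.
Proof.
split=> [|[d d0 hd]].
  rewrite near_withinE => /nbhs_ballP[d /= d0 hd]; exists d => // h hlt h0.
  by apply: hd => //; rewrite /ball /= sub0r normrN.
rewrite near_withinE; apply/nbhs_ballP; exists d => // h.
by rewrite /ball /= sub0r normrN => hlt h0; exact: hd.
Qed.

Lemma curve_deriv_cont (f : R -> E) t l : curve_deriv f t l -> {for t, continuous f}.
Proof.
move=> fl.
have h0 : f (t + h) @[h --> (0 : R)^'] --> f t.
  have : f t + h *: (h^-1 *: (f (t + h) - f t)) @[h --> (0 : R)^'] --> f t + (0 : R) *: l.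
    apply: tvs_cvgD; first exact: cvg_cst.
    by apply: tvs_cvgZ => //; exact: cvg_dnbhs0.
  rewrite scale0r addr0; apply: cvg_trans; apply: near_eq_cvg.
  near=> h; rewrite scalerA divff ?scale1r; first by rewrite addrC subrK.
  by near: h; exact: nbhs_dnbhs_neq.
move=> P Pt.
have /near_dnbhs0P[d d0 hd] : \forall h \near (0 : R)^', P (f (t + h)).
  exact: h0.
apply/nbhs_ballP; exists d => // x; rewrite /ball /= => xt.
have [->|ne] := eqVneq x t; first exact: nbhs_singleton.
by have := hd (x - t); rewrite distrC subr_eq0 addrCA subrr addr0; exact.
Unshelve. all: by end_near. Qed.

End MeanValue.

(** For e > 0 the function t |-> p (f b - f t) + g t + e t attains its maximum on
    [a, b].  At a point c < b the bound on p (f' c) makes it strictly larger at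
    c + h for small h > 0, so the maximum is attained at b; compare with the value
    at a and let e tend to 0. *)
Lemma mean_value {R : realType} {E : tvsType R} (p : E -> R)
    (f f' : R -> E) (g g' : R -> R) (a b : R) :
  continuous_seminorm p -> a <= b ->
  (forall t, a <= t <= b -> curve_deriv f t (f' t)) ->
  (forall t, a <= t <= b -> curve_deriv (g : R -> R^o) t (g' t)) ->
  (forall t, a <= t <= b -> p (f' t) <= g' t) ->
  p (f b - f a) <= g b - g a.
Proof.
move=> hp ab df dg fg.
apply/ler_addgt0Pr => e' e'0.
(* e (b - a) <= e', also when a = b *)
pose e := e' / (b - a + 1).
have ba1 : 0 < b - a + 1 by rewrite ltr_wpDl// subr_ge0.
have e0 : 0 < e by rewrite divr_gt0.
pose G t := p (f b - f t) + g t + e * t.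
have cG : {within `[a, b], continuous G}.
  apply: continuous_in_subspaceT => t; rewrite inE /= in_itv /= => tab.
  apply: cvgD; [apply: cvgD|].
  - apply: (continuous_seminorm_cvg hp); apply: tvs_cvgB; first exact: cvg_cst.
    exact: curve_deriv_cont (df t tab).
  - exact: (@curve_deriv_cont _ R^o g t _ (dg t tab)).
  - by apply: cvgM; [exact: cvg_cst|exact: cvg_id].
have [c cab maxc] := EVT_max ab cG; rewrite in_itv /= in cab.
have [cb|cb] := eqVneq c b.
  have := maxc a; rewrite in_itv /= lexx ab => /(_ isT).
  rewrite cb /G subrr (seminorm0 hp) add0r => h.
  have ee : e * (b - a) <= e'.
    rewrite /e -mulrA ger_pMr// mulrC ler_pdivrMr// mul1r lerDl.
    exact: ler01.
  by move: h ee; rewrite mulrBr; set X := p _; lra.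
(* c < b: the function is larger at c + h, for h small enough *)
exfalso.
have cltb : c < b by rewrite lt_neqAle cb; case/andP: cab.
have e2 : 0 < e / 2 by rewrite divr_gt0.
have /seminorm_cvgP/(_ p hp _ e2) H1 := df c cab.
have /cvgrPdist_lt/(_ _ e2) H2 : (h^-1 * (g (c + h) - g c)) @[h --> (0 : R)^'] --> g' c.
  exact: (dg c cab).
have /near_dnbhs0P[d d0 hd] : \forall h \near (0 : R)^',
    p (h^-1 *: (f (c + h) - f c) - f' c) < e / 2 /\
    `|g' c - h^-1 * (g (c + h) - g c)| < e / 2 by exact: filterI.
pose h := Num.min d (b - c) / 2.
have m0 : 0 < Num.min d (b - c) by rewrite lt_min d0 subr_gt0.
have h0 : 0 < h by rewrite divr_gt0.
have hm : h < Num.min d (b - c) by rewrite ltr_pdivrMr// ltr_pMr// ltr1n.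
move: (hm); rewrite lt_min => /andP[hltd hbc].
have [||h1 h2] := hd h.
  by rewrite gtr0_norm.
  by rewrite gt_eqF.
have chab : a <= c + h <= b.
  by case/andP: cab => ? ?; apply/andP; split; lra.
have := maxc (c + h); rewrite in_itv /= => /(_ chab).
apply/negP; rewrite -ltNge /G.
have k1 : p (f (c + h) - f c) <= h * (g' c + e / 2).
  have -> : f (c + h) - f c = h *: (h^-1 *: (f (c + h) - f c)).
    by rewrite scalerA divff ?scale1r// gt_eqF.
  rewrite seminormZ// gtr0_norm// ler_pM2l//.
  apply: (le_trans (seminorm_le_sub _ (f' c) hp)).
  by rewrite addrC lerD// ?fg// ltW.
have k2 : h * (g' c - e / 2) < g (c + h) - g c.
  rewrite -ltr_pdivlMl//.
  by move: h2; rewrite ltr_norml => /andP[_]; set X := _ * _; lra.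
have k3 : p (f b - f c) <= p (f b - f (c + h)) + p (f (c + h) - f c).
  by rewrite (le_trans _ (seminorm_triangle _ _ hp))// addrA subrK.
move: k1 k2 k3; rewrite !mulrDr mulrN.
by set X := h * _; set Y := h * _; set Z := p _; rewrite (mulrC e h) /Y; lra.
Qed.

Section CurveRules.
Context {R : realType} {E : tvsType R}.
Implicit Types (f g : R -> E) (t : R) (l : E).

Lemma mul_dnbhs0 (s : R) : s != 0 -> h * s @[h --> (0 : R)^'] --> (0 : R)^'.
Proof.
move=> s0 P /near_dnbhs0P[d d0 hd]; apply/near_dnbhs0P.
exists (d / `|s|); first by rewrite divr_gt0// normr_gt0.
move=> h hlt h0; apply: hd; last by rewrite mulf_neq0.
by rewrite normrM -ltr_pdivlMr// normr_gt0.
Qed.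

Lemma curve_derivD f g t l l' : curve_deriv f t l -> curve_deriv g t l' ->
  curve_deriv (fun s => f s + g s) t (l + l').
Proof.
move=> fl gl; rewrite /curve_deriv.
under eq_fun do rewrite opprD addrACA scalerDr.
exact: tvs_cvgD.
Qed.

Lemma curve_derivZ (k : R) f t l : curve_deriv f t l ->
  curve_deriv (fun s => k *: f s) t (k *: l).
Proof.
move=> fl; rewrite /curve_deriv.
under eq_fun do rewrite -scalerBr scalerA mulrC -scalerA.
by apply: tvs_cvgZ => //; exact: cvg_cst.
Qed.

Lemma curve_derivB f g t l l' : curve_deriv f t l -> curve_deriv g t l' ->
  curve_deriv (fun s => f s - g s) t (l - l').
Proof.
move=> fl gl; have := curve_derivD fl (@curve_derivZ (-1) _ _ _ gl).
by rewrite scaleN1r; under eq_fun do rewrite scaleN1r.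
Qed.

Lemma curve_deriv_cst (c : E) t : curve_deriv (cst c) t 0.
Proof.
rewrite /curve_deriv; under eq_fun do rewrite subrr scaler0.
exact: cvg_cst.
Qed.

Lemma curve_deriv_near f g t l : (\forall s \near t, f s = g s) ->
  curve_deriv f t l -> curve_deriv g t l.
Proof.
move=> /nbhs_ballP[d /= d0 hd]; apply: cvg_trans; apply: near_eq_cvg.
apply/near_dnbhs0P; exists d => // h hlt _.
rewrite !hd//; first exact: ballxx.
by rewrite /ball /= opprD addrA subrr add0r normrN.
Qed.

Lemma curve_deriv_sum (n : nat) (F : nat -> R -> E) (F' : nat -> E) t :
  (forall i, (i < n)%N -> curve_deriv (F i) t (F' i)) ->
  curve_deriv (fun s => \sum_(0 <= i < n) F i s) t (\sum_(0 <= i < n) F' i).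
Proof.
elim: n => [|n IH] h.
  rewrite big_geq//; under eq_fun do rewrite big_geq//.
  exact: curve_deriv_cst.
rewrite big_nat_recr//=.
have -> : (fun s => \sum_(0 <= i < n.+1) F i s) =
    (fun s => \sum_(0 <= i < n) F i s + F n s).
  by apply/funext => s; rewrite big_nat_recr.
by apply: curve_derivD; [apply: IH => i ilt; apply: h; exact: ltnW|exact: h].
Qed.

Lemma curve_deriv_affine f (a k : R) t l :
  curve_deriv f (a + k * t) l -> curve_deriv (fun s => f (a + k * s)) t (k *: l).
Proof.
move=> fl; have [->|k0] := eqVneq k 0.
  rewrite scale0r; under eq_fun do rewrite mul0r.
  exact: curve_deriv_cst.
rewrite /curve_deriv.
have -> : (fun h : R => h^-1 *: (f (a + k * (t + h)) - f (a + k * t))) =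
    (fun h : R => k *: ((h * k)^-1 *: (f (a + k * t + h * k) - f (a + k * t)))).
  apply/funext => h; rewrite scalerA invfM mulrCA divff// mulr1.
  by rewrite mulrDr addrA [k * h]mulrC.
apply: tvs_cvgZ; first exact: cvg_cst.
exact: (cvg_comp _ _ (mul_dnbhs0 k0) fl).
Qed.

Lemma curve_deriv_unique (hE : hausdorff_space E) f t l l' :
  curve_deriv f t l -> curve_deriv f t l' -> l = l'.
Proof. by move=> h h'; exact: (cvg_unique hE h h'). Qed.

End CurveRules.

Lemma curve_deriv_scal {R : realType} {E : tvsType R} (f : R -> R) (t l : R) (w : E) :
  curve_deriv (f : R -> R^o) t l -> curve_deriv (fun s => f s *: w) t (l *: w).
Proof.
move=> fl; rewrite /curve_deriv.
under eq_fun do rewrite -scalerBl scalerA.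
by apply: tvs_cvgZ; [exact: fl|exact: cvg_cst].
Qed.

Lemma curve_deriv_id {R : realType} (t : R) : curve_deriv (id : R -> R^o) t 1.
Proof.
rewrite /curve_deriv; apply: cvg_near_cst; apply/near_dnbhs0P; exists 1 => // h _ h0.
by rewrite addrAC subrr add0r [LHS]mulVf.
Qed.

Lemma is_derive_curve {R : realType} (f : R -> R) (t l : R) :
  is_derive t 1 f l -> curve_deriv (f : R -> R^o) t l.
Proof.
case=> df <-; rewrite /curve_deriv.
apply: (@cvg_ext _ _ _ (fun h => h^-1 *: ((f \o shift t) (h *: 1) - f t))); last exact: df.
by move=> h /=; rewrite [h *: 1]mulr1 [h + t]addrC.
Qed.

Lemma curve_deriv_pow {R : realType} (n : nat) (t : R) :
  curve_deriv (fun s => s ^+ n.+1 / n.+1`!%:R : R^o) t (t ^+ n / n`!%:R).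
Proof.
have h : is_derive t 1 (fun s : R => s ^+ n.+1) (n.+1%:R * t ^+ n).
  have := @is_deriveX _ _ id n.+1 t 1 1 (is_derive_id _ _).
  by rewrite exprfctE [X in is_derive _ _ _ X]mulr1.
have := @curve_derivZ _ R^o (n.+1`!%:R^-1) _ _ _ (is_derive_curve h).
congr (curve_deriv _ _ _).
  by apply/funext => s; rewrite [LHS]mulrC.
rewrite factS natrM [LHS]mulrC invfM -mulrA mulrCA; congr (_ * _).
by rewrite mulrA divff ?mul1r// pnatr_eq0.
Qed.

(** * Continuously differentiable maps *)

Section Strict.
Context {R : realType} {F E : tvsType R} (hE : hausdorff_space E).
Implicit Types (f : F -> E) (x v : F).

Lemma dir_deriveP f x v l : has_deriv f x v l -> dir_derive f x v = l.
Proof.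
move=> fl; rewrite /dir_derive /limit.
by case: xgetP => [l' _ fl'|/(_ l)//]; exact: (cvg_unique hE fl' fl).
Qed.

Lemma dir_derivableP f x v : dir_derivable f x v <-> has_deriv f x v (dir_derive f x v).
Proof.
split; last by exists (dir_derive f x v).
by move=> [l fl]; rewrite (dir_deriveP fl).
Qed.

Lemma has_derivE f x v l : has_deriv f x v l = curve_deriv (fun s => f (x + s *: v)) 0 l.
Proof.
rewrite /has_deriv /curve_deriv /dquot.
by under [in RHS]eq_fun do rewrite add0r scale0r addr0.
Qed.

Lemma has_deriv_near f g x v l : (\forall y \near x, f y = g y) ->
  has_deriv f x v l -> has_deriv g x v l.
Proof.
rewrite !has_derivE => fg; apply: curve_deriv_near.
have h : x + s *: v @[s --> (0 : R)] --> x + (0 : R) *: v.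
  apply: tvs_cvgD; first exact: cvg_cst.
  by apply: tvs_cvgZ; [exact: cvg_id|exact: cvg_cst].
by have := h [set z | f z = g z]; rewrite scale0r addr0; exact.
Qed.

Definition C1_at f x : Prop := {for x, continuous f} /\
  forall v, has_deriv f x v (dir_derive f x v) /\
            {for (x, v), continuous (fun z : F * F => dir_derive f z.1 z.2)}.

(** C1 at all points near a given one: unlike with a fixed open set, no domain has to
    be tracked when maps are composed or read in charts. *)
Definition C1_near f x : Prop := \forall y \near x, C1_at f y.

Lemma C1_near_at f x : C1_near f x -> C1_at f x.
Proof. exact: nbhs_singleton. Qed.

Lemma C1_near_near f x : C1_near f x -> \forall y \near x, C1_near f y.
Proof. exact: nbhs_interior. Qed.

(** Along the segment from a to a + s q, the derivative of f / s in the parameter th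
    is D f(a + th s q)(q), which is close to D f(x)(v) by continuity of
    (y, w) |-> D f(y)(w); the mean value inequality concludes.  Base point and direction both vary: the
    former is used for additivity of D f(x), the latter for the chain rule. *)
Lemma strict_deriv f x v T (P : set_system T) {FP : Filter P}
    (a q : T -> F) (s : T -> R) :
  C1_near f x -> a @ P --> x -> q @ P --> v -> s @ P --> (0 : R)^' ->
  (s i)^-1 *: (f (a i + s i *: q i) - f (a i)) @[i --> P] --> dir_derive f x v.
Proof.
move=> f1 ax qv s0; apply/seminorm_cvgP => p hp e e0.
have [_ /(_ v)[_ Dc]] := C1_near_at f1.
have e2 : 0 < e / 2 by rewrite divr_gt0.
have /seminorm_cvgP/(_ p hp _ e2) := Dc => /= -[[A B] /= [Ax Bv] AB].
(* a ball of r is convex, so that it contains the segment as soon as s is small *)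
have [r hr rA] : exists2 r, continuous_seminorm r &
    forall y, r (y - x) < 1 -> A y /\ C1_at f y.
  have Af : nbhs x (A `&` [set y | C1_at f y]) by exact: filterI.
  have : nbhs (- x + x) [set - x + z | z in A `&` [set y | C1_at f y]] by exact: nbhsB.
  rewrite addNr => /seminorm_nbhs[r hr rA]; exists r => // y /rA[z Az].
  by rewrite addrC => /addIr <-.
have r2 : 0 < 1 / 2 :> R by rewrite divr_gt0.
have s0' : s @ P --> (0 : R) by apply: cvg_trans s0 _; exact: nbhs_dnbhs.
have sq : s i *: q i @[i --> P] --> (0 : F).
  by rewrite -(scale0r v); exact: tvs_cvgZ.
have n1 : \forall i \near P, r (a i - x) < 1 / 2.
  exact: (seminorm_cvgP _ _).1 ax r hr _ r2.
have n2 : \forall i \near P, r (s i *: q i - 0) < 1 / 2.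
  exact: (seminorm_cvgP _ _).1 sq r hr _ r2.
have n3 : \forall i \near P, B (q i) by exact: qv.
have n4 : \forall i \near P, s i != 0.
  by apply: (s0 [set h | h != 0]); by apply/near_dnbhs0P; exists 1.
near=> i.
have m1 : r (a i - x) < 1 / 2 by near: i.
have m2 : r (s i *: q i - 0) < 1 / 2 by near: i.
have Bq : B (q i) by near: i.
have si0 : s i != 0 by near: i.
rewrite subr0 in m2.
have seg th : 0 <= th -> th <= 1 ->
    A (a i + (th * s i) *: q i) /\ C1_at f (a i + (th * s i) *: q i).
  move=> th0 th1; apply: rA; rewrite addrAC -scalerA.
  apply: (le_lt_trans (seminorm_triangle _ _ hr)).
  rewrite (seminormZ _ _ hr) ger0_norm//.
  have := seminorm_ge0 (s i *: q i) hr.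
  move: m1 m2; set X := r _; set Y := r _ => ? ? ?.
  have : th * Y <= 1 * Y by rewrite ler_wpM2r.
  by lra.
pose h (th : R) := (s i)^-1 *: f (a i + (th * s i) *: q i) - th *: dir_derive f x v.
have -> : (s i)^-1 *: (f (a i + s i *: q i) - f (a i)) - dir_derive f x v = h 1 - h 0.
  by rewrite /h !mul0r !mul1r scale0r addr0 scale0r subr0 scale1r scalerBr addrAC.
apply: (@le_lt_trans _ _ (e / 2 * 1 - e / 2 * 0)); last first.
  by rewrite mulr0 mulr1 subr0 ltr_pdivrMr// ltr_pMr// ltr1n.
apply: (@mean_value _ _ p h
  (fun th => dir_derive f (a i + (th * s i) *: q i) (q i) - dir_derive f x v)
  (fun th => e / 2 * th) (fun=> e / 2)) => // th /andP[th0 th1].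
- apply: curve_derivB; last first.
    by rewrite -[X in curve_deriv _ _ X]scale1r; apply: curve_deriv_scal; exact: curve_deriv_id.
  have [_ [_ /(_ (q i))[+ _]]] := seg th th0 th1.
  rewrite /has_deriv /curve_deriv => hd.
  apply: cvg_ext (cvg_comp _ _ (mul_dnbhs0 si0) hd) => u /=.
  by rewrite /dquot invfM -scalerBr scalerA mulrDl scalerDl addrA.
- have := @curve_derivZ _ R^o (e / 2) _ th _ (curve_deriv_id th).
  by rewrite [X in curve_deriv _ _ X]mulr1.
- have [Ay _] := seg th th0 th1.
  by apply/ltW; exact: (AB (_, q i)).
Unshelve. all: by end_near. Qed.

End Strict.

Section LinearDerivative.
Context {R : realType} {F E : tvsType R} (hE : hausdorff_space E).
Implicit Types (f : F -> E) (x v : F).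

Lemma dir_deriveZ f x (k : R) v : C1_at f x ->
  dir_derive f x (k *: v) = k *: dir_derive f x v.
Proof.
case=> _ /(_ v)[+ _]; rewrite has_derivE => fv; apply: dir_deriveP => //.
rewrite has_derivE.
have fv' : curve_deriv (fun s => f (x + s *: v)) (0 + k * 0) (dir_derive f x v).
  by rewrite mulr0 addr0.
apply: cvg_ext (curve_deriv_affine fv') => h.
by rewrite !add0r !mulr0 !scale0r !scalerA [h * k]mulrC.
Qed.

Lemma dir_derive0 f x : C1_at f x -> dir_derive f x 0 = 0.
Proof. by move=> fx; rewrite -(scale0r 0) dir_deriveZ// scale0r. Qed.

(** The increment along v + w is the sum of one along v and of one along w, the
    latter starting from the moving point x + t v, as [strict_deriv] permits. *)
Lemma dir_deriveD f x v w : C1_near f x ->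
  dir_derive f x (v + w) = dir_derive f x v + dir_derive f x w.
Proof.
move=> fx; apply: dir_deriveP => //.
have [_ /(_ v)[hv _]] := C1_near_at fx.
have a0 : x + t *: v @[t --> (0 : R)^'] --> x.
  rewrite -[X in _ --> X]addr0 -(scale0r v).
  apply: tvs_cvgD; first exact: cvg_cst.
  by apply: tvs_cvgZ; [exact: cvg_dnbhs0|exact: cvg_cst].
have hw : t^-1 *: (f (x + t *: v + t *: w) - f (x + t *: v)) @[t --> (0 : R)^']
    --> dir_derive f x w.
  by apply: (strict_deriv fx a0) => //; exact: cvg_cst.
apply: cvg_ext (tvs_cvgD hv hw) => t /=.
by rewrite /dquot -scalerDr; congr (_ *: _); rewrite [LHS]addrC addrA subrK scalerDr addrA.
Qed.

Lemma curve_deriv_comp f (c : R -> F) t l : C1_near f (c t) ->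
  curve_deriv c t l -> curve_deriv (fun s => f (c s)) t (dir_derive f (c t) l).
Proof.
move=> fx cl.
have h : h^-1 *: (f (c t + h *: (h^-1 *: (c (t + h) - c t))) - f (c t))
    @[h --> (0 : R)^'] --> dir_derive f (c t) l.
  by apply: (strict_deriv fx) => //; exact: cvg_cst.
apply: cvg_trans h; apply: near_eq_cvg; apply/near_dnbhs0P; exists 1 => // h _ h0.
by rewrite scalerA divff// scale1r addrCA subrr addr0.
Qed.

(** Continuity is easier to prove for an explicit candidate f' than for
    [dir_derive], whose values are chosen by [limit]. *)
Lemma C1_intro f (f' : F -> F -> E) x :
  (\forall y \near x, {for y, continuous f} /\ forall v,
     has_deriv f y v (f' y v) /\
     {for (y, v), continuous (fun z : F * F => f' z.1 z.2)}) ->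
  C1_near f x /\ forall v, dir_derive f x v = f' x v.
Proof.
move=> h; split; last first.
  by move=> v; apply: dir_deriveP => //; have [_ /(_ v)[]] := nbhs_singleton h.
have := nbhs_interior h; apply: filterS => y hy.
have [fy hv] := nbhs_singleton hy; split=> // v; have [d c] := hv v; split.
  by rewrite (dir_deriveP hE d).
rewrite /prop_for /continuous_at /= (dir_deriveP hE d).
apply: cvg_trans c; apply: near_eq_cvg.
have := near_fst v hy.
apply: filterS => z [_ /(_ z.2)[dz _]].
by rewrite (dir_deriveP hE dz).
Qed.

Lemma C1_near_ext f g x : (\forall y \near x, f y = g y) -> C1_near f x -> C1_near g x.
Proof.
move=> fg fx.
have [|//] := @C1_intro g (dir_derive f) x.
apply: filterS2 (nbhs_interior fg) (C1_near_near fx) => y fgn fy.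
have [cf df] := C1_near_at fy; have fgy := nbhs_singleton fgn.
split; first by apply: cvg_trans (cvg_trans _ cf) _; [exact: near_eq_cvg|rewrite fgy].
by move=> v; have [d c] := df v; split => //; exact: has_deriv_near d.
Qed.

Lemma C1_affine f (L : F -> E) x : continuous f -> continuous L ->
  (forall y v (t : R), f (y + t *: v) = f y + t *: L v) ->
  C1_near f x /\ forall v, dir_derive f x v = L v.
Proof.
move=> fc Lc fL; apply: (@C1_intro f (fun=> L)); apply: nearW => y.
split; first exact: fc.
move=> v; split; last by apply: (@cvg_comp _ _ _ snd L _ (nbhs v)); [exact: cvg_snd|exact: Lc].
apply: cvg_near_cst; apply/near_dnbhs0P; exists 1 => // t _ t0.
by rewrite /dquot fL [_ + t *: _]addrC addrK scalerA mulVf ?scale1r.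
Qed.

Lemma seminorm_derive (f : F -> E) x (p : E -> R) : C1_near f x ->
  continuous_seminorm p -> continuous_seminorm (fun v => p (dir_derive f x v)).
Proof.
move=> fx hp; split=> [v w|a v|v].
- by rewrite dir_deriveD// seminorm_triangle.
- by rewrite dir_deriveZ ?seminormZ//; exact: C1_near_at.
- have [_ /(_ v)[_ c]] := C1_near_at fx.
  have q : (x, w) @[w --> v] --> (x, v) by apply: cvg_pair; [exact: cvg_cst|exact: cvg_id].
  exact: (continuous_seminorm_cvg hp (cvg_at c q)).
Qed.

End LinearDerivative.

Section Composition.
Context {R : realType} {H F E : tvsType R}.
Hypotheses (hF : hausdorff_space F) (hE : hausdorff_space E).

Lemma has_deriv_comp (g : H -> F) (f : F -> E) y v l : C1_near f (g y) ->
  has_deriv g y v l -> has_deriv (fun z => f (g z)) y v (dir_derive f (g y) l).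
Proof.
rewrite !has_derivE => fx gl.
have fx' : C1_near f (g (y + 0 *: v)) by rewrite scale0r addr0.
have := curve_deriv_comp fx' gl.
by rewrite scale0r addr0.
Qed.

Lemma C1_comp (g : H -> F) (f : F -> E) y : C1_near g y -> C1_near f (g y) ->
  C1_near (fun z => f (g z)) y /\
  forall v, dir_derive (fun z => f (g z)) y v = dir_derive f (g y) (dir_derive g y v).
Proof.
move=> gy fg; apply: (@C1_intro _ _ _ hE _
  (fun y v => dir_derive f (g y) (dir_derive g y v))).
have [gc _] := C1_near_at gy.
apply: filterS2 gy (gc _ (C1_near_near fg)) => z /= [gz dg] fz; have [fc df] := C1_near_at fz.
split; first exact: (@cvg_comp _ _ _ g f _ (nbhs (g z))).
move=> v; have [d c] := dg v; split; first exact: has_deriv_comp.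
have [_ cf] := df (dir_derive g z v).
apply: (@cvg_comp _ _ _ (fun w : H * H => (g w.1, dir_derive g w.1 w.2))
   (fun w : F * F => dir_derive f w.1 w.2) _
   (nbhs (g z, dir_derive g z v))) => //.
apply: cvg_pair => //=.
by apply: (@cvg_comp _ _ _ fst g _ (nbhs z)) => //; exact: cvg_fst.
Qed.

Lemma has_deriv_pair (g : H -> F) (h : H -> E) y v l m :
  has_deriv g y v l -> has_deriv h y v m ->
  has_deriv (fun z => (g z, h z)) y v (l, m).
Proof. by move=> gl hm; exact: cvg_pair gl hm. Qed.

Lemma C1_pair (g : H -> F) (h : H -> E) y : C1_near g y -> C1_near h y ->
  C1_near (fun z => (g z, h z)) y /\
  forall v, dir_derive (fun z => (g z, h z)) y v = (dir_derive g y v, dir_derive h y v).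
Proof.
move=> gy hy.
apply: (@C1_intro _ _ _ (hausdorff_prod hF hE) _ (fun y v => (dir_derive g y v, dir_derive h y v))).
apply: filterS2 gy hy => z [gz dg] [hz dh].
split; first exact: cvg_pair.
move=> v; have [d c] := dg v; have [d' c'] := dh v; split.
  exact: has_deriv_pair.
exact: cvg_pair.
Qed.

End Composition.

Section SecondOrder.
Context {R : realType} {F E : tvsType R} (hE : hausdorff_space E).
Implicit Types (f : F -> E) (x : F).

(** The inner derivative is taken in a fixed direction, as in [iter_derive]. *)
Definition C2_near f x : Prop := C1_near f x /\
  \forall y \near x, forall v w,
  has_deriv (fun z => dir_derive f z v) y w
    (dir_derive (fun z => dir_derive f z v) y w) /\
  {for ((y, v), w), continuous
    (fun z : F * F * F => dir_derive (fun z' => dir_derive f z' z.1.2) z.1.1 z.2)}.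

(** The partial derivative in the second variable exists since D f(y) is linear;
    the derivative at (y, u) in the direction (a, b) is D_a D_u f(y) + D_b f(y). *)
Lemma C1_tangent f x v : C2_near f x ->
  C1_near (fun z : F * F => dir_derive f z.1 z.2) (x, v).
Proof.
move=> [f1 f2].
have [|//] := @C1_intro _ (F * F)%type _ hE (fun z => dir_derive f z.1 z.2)
  (fun z w : F * F =>
   dir_derive (fun z' => dir_derive f z' z.2) z.1 w.1 + dir_derive f z.1 w.2) (x, v).
apply: filterS2 (near_fst v (C1_near_near f1)) (near_fst v f2) => -[y u] /= fy d2.
have [_ d1] := C1_near_at fy.
split; first by have [] := d1 u.
move=> [a b]; split => /=.
  have [da _] := d2 u a.
  have yta : y + t *: a @[t --> (0 : R)^'] --> y.
    rewrite -[X in _ --> X]addr0 -(scale0r a).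
    apply: tvs_cvgD; first exact: cvg_cst.
    by apply: tvs_cvgZ; [exact: cvg_dnbhs0|exact: cvg_cst].
  have db : dir_derive f (y + t *: a) b @[t --> (0 : R)^'] --> dir_derive f y b.
    have [_ cb] := d1 b.
    apply: (@cvg_comp _ _ _ (fun t => (y + t *: a, b))
      (fun w : F * F => dir_derive f w.1 w.2) _ (nbhs (y, b))) => //.
    by apply: cvg_pair => //; exact: cvg_cst.
  apply: cvg_trans (tvs_cvgD da db); apply: near_eq_cvg.
  have n1 : \forall t \near (0 : R)^', C1_near f (y + t *: a).
    exact: yta (C1_near_near fy).
  have n2 : \forall t \near (0 : R)^', t != 0 by apply/near_dnbhs0P; exists 1.
  apply: filterS2 n1 n2 => t ft t0.
  rewrite /dquot /= (dir_deriveD hE _ _ ft) (dir_deriveZ hE _ _ (C1_near_at ft)).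
  by rewrite [in RHS]addrAC [RHS]scalerDr scalerA mulVf// scale1r.
have [_ ca] := d2 u a; have [_ cb] := d1 b.
have p1 : w.1 @[w --> ((y, u), (a, b))] --> (y, u) by exact: cvg_fst.
have p2 : w.2 @[w --> ((y, u), (a, b))] --> (a, b) by exact: cvg_snd.
have p11 : w.1.1 @[w --> ((y, u), (a, b))] --> y.
  by apply: (cvg_comp _ _ p1); exact: cvg_fst.
have p21 : w.2.1 @[w --> ((y, u), (a, b))] --> a.
  by apply: (cvg_comp _ _ p2); exact: cvg_fst.
have p22 : w.2.2 @[w --> ((y, u), (a, b))] --> b.
  by apply: (cvg_comp _ _ p2); exact: cvg_snd.
apply: tvs_cvgD.
  exact: (cvg_at (f := fun w : F * F * (F * F) => (w.1, w.2.1)) ca (cvg_pair p1 p21)).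
exact: (cvg_at (f := fun w : F * F * (F * F) => (w.1.1, w.2.2)) cb (cvg_pair p11 p22)).
Qed.

Lemma cvg_row p (T : Type) (P : set_system T) {FP : Filter P} (c : T -> 'rV[F]_p)
    (l : 'rV[F]_p) :
  (forall i, c x ord0 i @[x --> P] --> l ord0 i) -> c @ P --> l.
Proof.
move=> cl A [Q hQ QA].
have : \forall x \near P, forall i, Q ord0 i (c x ord0 i).
  by apply: filter_forall => i; apply: cl; exact: hQ.
apply: filterS => x hx; apply: QA => i j.
by rewrite (ord1 i).
Qed.

Let nbhs_setX_rV p (U : set F) (y : F) (r : 'rV[F]_p) : nbhs y U ->
  nbhs (y, r) (U `*` [set: 'rV[F]_p]).
Proof. by move=> Uy; exists (U, setT) => //; split => //=; exact: filterT. Qed.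

Lemma Ck1_C1 (U : set F) f x : nbhs x U -> Ck 1 U f -> C1_near f x.
Proof.
move=> nU [df cf].
apply: filterS (nbhs_interior nU) => y nUy; have Uy := nbhs_singleton nUy; split.
  have h := within_nbhs_continuous (nbhs_setX_rV (0 : 'rV_0) nUy) (cf 0%N isT).
  have := cvg_at (f := fun z => (z, 0 : 'rV[F]_0)) h (cvg_pair cvg_id (cvg_cst _)).
  by rewrite /= enum_ord0; exact.
move=> v; split; first by apply/(dir_derivableP hE); exact: (df [::]).
pose r (w : F) : 'rV[F]_1 := \row_i w.
have h := within_nbhs_continuous (nbhs_setX_rV (r v) nUy) (cf 1%N isT).
have hr : r z.2 @[z --> (y, v)] --> r v.
  by apply: cvg_row => i; under eq_fun do rewrite mxE; rewrite mxE; exact: cvg_snd.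
have := cvg_at (f := fun z => (z.1, r z.2)) h (cvg_pair cvg_fst hr).
have E1 w : [seq (r w) ord0 i | i <- enum 'I_1] = [:: w].
  by rewrite enum_ordSl enum_ord0 /= mxE.
by rewrite /= E1; under eq_fun do rewrite E1; exact.
Qed.

Lemma Ck2_C2 (U : set F) f x : nbhs x U -> Ck 2 U f -> C2_near f x.
Proof.
move=> nU [df cf]; split.
  apply: (Ck1_C1 nU); split=> [vs v y h|p h]; first by apply: df; exact: ltnW.
  by apply: cf; exact: leqW.
apply: filterS (nbhs_interior nU) => y nUy v w.
have Uy := nbhs_singleton nUy; split.
  by apply/(dir_derivableP hE); exact: (df [:: v]).
pose r (w : F * F) : 'rV[F]_2 := \row_i (if i == ord0 then w.1 else w.2).
have h := within_nbhs_continuous (nbhs_setX_rV (r (v, w)) nUy) (cf 2%N isT).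
have hr : r (z.1.2, z.2) @[z --> (y, v, w)] --> r (v, w).
  apply: cvg_row => i; under eq_fun do rewrite mxE; rewrite mxE.
  case: ifP => _ /=; last exact: cvg_snd.
  by apply: (cvg_comp _ _ cvg_fst); exact: cvg_snd.
have hz : z.1.1 @[z --> (y, v, w)] --> y.
  by apply: (cvg_comp _ _ cvg_fst); exact: cvg_fst.
have := cvg_at (f := fun z => (z.1.1, r (z.1.2, z.2))) h (cvg_pair hz hr).
have E2 u : [seq (r u) ord0 i | i <- enum 'I_2] = [:: u.1; u.2].
  by rewrite !enum_ordSl enum_ord0 /= !mxE.
by rewrite /= E2; under eq_fun do rewrite E2; exact.
Qed.

End SecondOrder.

(** * Velocities of curves in the group *)

Section Charts.
Context {R : realType} {E : tvsType R} (hE : hausdorff_space E) {G : milnorLieType E}.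
Implicit Types (c : chart E G) (mu nu : R -> G) (g h : G) (t : R) (v w : E).

Lemma chart_at_atlas g : atlas (chart_at g).
Proof. by rewrite /chart_at; case: cid => c []. Qed.

Lemma chart_at_dom g : cdom (chart_at g) g.
Proof. by rewrite /chart_at; case: cid => c []. Qed.
Hint Resolve chart_at_atlas chart_at_dom : core.

Lemma cdom_nbhs c g : cdom c g -> nbhs g (cdom c).
Proof. by move=> cg; apply: open_nbhs_nbhs; split=> //; exact: cdom_open. Qed.

Lemma ccod_nbhs c u : ccod c u -> nbhs u (ccod c).
Proof. by move=> cu; apply: open_nbhs_nbhs; split=> //; exact: ccod_open. Qed.

Lemma cmap_cont c g : cdom c g -> {for g, continuous (cmap c)}.
Proof.
by move=> cg; apply: (within_nbhs_continuous (cdom_nbhs cg)); exact: cmap_continuous.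
Qed.

Lemma cinv_cont c u : ccod c u -> {for u, continuous (cinv c)}.
Proof.
by move=> cu; apply: (within_nbhs_continuous (ccod_nbhs cu)); exact: cinv_continuous.
Qed.

Lemma mul_cvg T (F : set_system T) {FF : Filter F} (f k : T -> G) g h :
  f @ F --> g -> k @ F --> h -> (f x * k x)%g @[x --> F] --> (g * h)%g.
Proof. by move=> fg kh; exact: (cvg_comp _ _ (cvg_pair fg kh) (@lie_mul_continuous _ _ G (g, h))). Qed.

Lemma inv_cvg T (F : set_system T) {FF : Filter F} (f : T -> G) g :
  f @ F --> g -> (f x)^-1%g @[x --> F] --> (g^-1)%g.
Proof. by move=> fg; exact: (cvg_comp _ _ fg (@lie_inv_continuous _ _ G g)). Qed.

Definition chart_mul c1 c2 c3 (z : E * E) : E := cmap c3 (cinv c1 z.1 * cinv c2 z.2)%g.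

Definition chart_inv c1 c2 (u : E) : E := cmap c2 (cinv c1 u)^-1%g.

Lemma chart_mul_C2 c1 c2 c3 g h : atlas c1 -> atlas c2 -> atlas c3 ->
  cdom c1 g -> cdom c2 h -> cdom c3 (g * h)%g ->
  C2_near (chart_mul c1 c2 c3) (cmap c1 g, cmap c2 h).
Proof.
move=> a1 a2 a3 cg ch cgh.
have := lie_mul_smooth c1 c2 c3 a1 a2 a3 2; apply: (Ck2_C2 hE).
have p1 : z.1 @[z --> (cmap c1 g, cmap c2 h)] --> cmap c1 g by exact: cvg_fst.
have p2 : z.2 @[z --> (cmap c1 g, cmap c2 h)] --> cmap c2 h by exact: cvg_snd.
have q1 := cvg_at (cinv_cont (cmap_cod cg)) p1.
have q2 := cvg_at (cinv_cont (cmap_cod ch)) p2.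
rewrite cmapK// in q1; rewrite cmapK// in q2.
have n1 : \forall z \near (cmap c1 g, cmap c2 h), ccod c1 z.1.
  exact: (p1 _ (ccod_nbhs (cmap_cod cg))).
have n2 : \forall z \near (cmap c1 g, cmap c2 h), ccod c2 z.2.
  exact: (p2 _ (ccod_nbhs (cmap_cod ch))).
have n3 : \forall z \near (cmap c1 g, cmap c2 h),
    cdom c3 (cinv c1 z.1 * cinv c2 z.2)%g.
  exact: (mul_cvg q1 q2 (cdom_nbhs cgh)).
by apply: filterS3 n1 n2 n3 => z z1 z2 z3.
Qed.

Lemma chart_inv_C1 c1 c2 g : atlas c1 -> atlas c2 -> cdom c1 g -> cdom c2 g^-1%g ->
  C1_near (chart_inv c1 c2) (cmap c1 g).
Proof.
move=> a1 a2 cg cg'.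
have := lie_inv_smooth c1 c2 a1 a2 1; apply: (Ck1_C1 hE).
have q := cinv_cont (cmap_cod cg); rewrite /prop_for /continuous_at cmapK// in q.
have n2 : \forall z \near cmap c1 g, cdom c2 (cinv c1 z)^-1%g.
  exact: (inv_cvg q (cdom_nbhs cg')).
by apply: filterS2 (ccod_nbhs (cmap_cod cg)) n2 => z z1 z2.
Qed.

(** The velocity v is read in a given chart c around mu t, not only in [chart_at]. *)
Definition hasvel c mu t v : Prop :=
  [/\ cdom c (mu t), {for t, continuous mu} & curve_deriv (fun s => cmap c (mu s)) t v].

Lemma hasvel_unique c mu t v w : hasvel c mu t v -> hasvel c mu t w -> v = w.
Proof. by move=> [_ _ h] [_ _ h']; exact: curve_deriv_unique h h'. Qed.

Lemma hasvel_near_dom c mu t v : hasvel c mu t v -> \forall s \near t, cdom c (mu s).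
Proof. by move=> [d cm _]; exact: (cm _ (cdom_nbhs d)). Qed.

Lemma hasvel_cst c g t : cdom c g -> hasvel c (fun=> g) t 0.
Proof. by move=> cg; split=> //; [exact: cvg_cst|exact: curve_deriv_cst]. Qed.

Lemma hasvel_mul c1 c2 c3 mu nu t v w : atlas c1 -> atlas c2 -> atlas c3 ->
  hasvel c1 mu t v -> hasvel c2 nu t w -> cdom c3 (mu t * nu t)%g ->
  hasvel c3 (fun s => mu s * nu s)%g t
    (dir_derive (chart_mul c1 c2 c3) (cmap c1 (mu t), cmap c2 (nu t)) (v, w)).
Proof.
move=> a1 a2 a3 hm hn cmn.
have [dm cm vm] := hm; have [dn cn vn] := hn.
split=> //; first exact: mul_cvg.
have [M1 _] := chart_mul_C2 a1 a2 a3 dm dn cmn.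
have vmn : curve_deriv (fun s => (cmap c1 (mu s), cmap c2 (nu s)) : E * E) t (v, w).
  exact: cvg_pair vm vn.
apply: curve_deriv_near (curve_deriv_comp (c := fun s => (cmap c1 (mu s), cmap c2 (nu s))) M1 vmn).
apply: filterS2 (hasvel_near_dom hm) (hasvel_near_dom hn) => s ms ns.
by rewrite /chart_mul /= !cmapK.
Qed.

Lemma hasvel_inv c1 c2 mu t v : atlas c1 -> atlas c2 -> hasvel c1 mu t v ->
  cdom c2 (mu t)^-1%g ->
  hasvel c2 (fun s => (mu s)^-1)%g t (dir_derive (chart_inv c1 c2) (cmap c1 (mu t)) v).
Proof.
move=> a1 a2 hm cmi; have [dm cm vm] := hm.
split=> //; first exact: inv_cvg.
apply: curve_deriv_near (curve_deriv_comp (chart_inv_C1 a1 a2 dm cmi) vm).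
by apply: filterS (hasvel_near_dom hm) => s ms; rewrite /chart_inv cmapK.
Qed.

(** A test curve through g: the values of differentials are read off from the
    velocities of its images, by uniqueness of velocities. *)
Definition line c g v (s : R) : G := cinv c (cmap c g + s *: v).

Lemma line_cvg c g v : cmap c g + s *: v @[s --> (0 : R)] --> cmap c g.
Proof.
rewrite -[X in _ --> X]addr0 -(scale0r v).
apply: tvs_cvgD; first exact: cvg_cst.
by apply: tvs_cvgZ; [exact: cvg_id|exact: cvg_cst].
Qed.

Lemma line0 c g v : cdom c g -> line c g v 0 = g.
Proof. by move=> cg; rewrite /line scale0r addr0 cmapK. Qed.

Lemma hasvel_line c g v : cdom c g -> hasvel c (line c g v) 0 v.
Proof.
move=> cg; split; first by rewrite line0.
  rewrite /prop_for /continuous_at line0//.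
  have := cvg_at (cinv_cont (cmap_cod cg)) (@line_cvg c g v).
  by rewrite cmapK.
apply: (@curve_deriv_near _ _ (fun s => cmap c g + s *: v)).
  have h : \forall s \near (0 : R), ccod c (cmap c g + s *: v).
    exact: (@line_cvg c g v _ (ccod_nbhs (cmap_cod cg))).
  by apply: filterS h => s hs; rewrite /line cinvK.
rewrite -[v in curve_deriv _ _ v]scale1r -[X in curve_deriv _ _ X]add0r.
apply: curve_derivD; first exact: curve_deriv_cst.
by apply: curve_deriv_scal; exact: curve_deriv_id.
Qed.

(** Differentiability of class C1 near g, read in all charts. *)
Definition C1_map (f : G -> G) g : Prop := {for g, continuous f} /\
  forall c c', atlas c -> atlas c' -> cdom c g -> cdom c' (f g) ->
    C1_near (fun u => cmap c' (f (cinv c u))) (cmap c g).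

Lemma C1_map_comp (f k : G -> G) g : C1_map f g -> C1_map k (f g) ->
  C1_map (fun h => k (f h)) g.
Proof.
move=> [fc f1] [kc k1]; split; first exact: (cvg_at kc fc).
move=> c c' ac ac' cg ckg; pose d := chart_at (f g).
have fd := f1 c d ac (chart_at_atlas _) cg (chart_at_dom _).
have kd := k1 d c' (chart_at_atlas _) ac' (chart_at_dom _) ckg.
have [|h _] := @C1_comp _ _ _ _ hE _ (fun u => cmap c' (k (cinv d u))) _ fd.
  by rewrite cmapK.
apply: C1_near_ext h => //.
have q := cinv_cont (cmap_cod cg); rewrite /prop_for /continuous_at cmapK// in q.
have n : \forall u \near cmap c g, cdom d (f (cinv c u)).
  exact: (cvg_at fc q (cdom_nbhs (chart_at_dom (f g)))).
by apply: filterS n => u du; rewrite cmapK.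
Qed.

Lemma C1_map_lmul h g : C1_map (fun k => h * k)%g g.
Proof.
split; first by apply: mul_cvg; [exact: cvg_cst|exact: cvg_id].
move=> c c' ac ac' cg chg; pose d := chart_at h.
have M := chart_mul_C2 (chart_at_atlas h) ac ac' (chart_at_dom h) cg chg.
pose i (u : E) := (cmap d h, u).
have [|||i1 _] := @C1_affine _ _ _ (hausdorff_prod hE hE) i (fun u => (0, u)) (cmap c g).
- by move=> u; apply: cvg_pair; [exact: cvg_cst|exact: cvg_id].
- by move=> u; apply: cvg_pair; [exact: cvg_cst|exact: cvg_id].
- by move=> u v t; congr pair; rewrite /= scaler0 addr0.
have [+ _] := @C1_comp _ _ _ _ hE i (chart_mul d c c') (cmap c g) i1 M.1.
by apply: (C1_near_ext hE); apply: nearW => u; rewrite /chart_mul /i /d /= cmapK.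
Qed.

Lemma C1_map_rmul h g : C1_map (fun k => k * h)%g g.
Proof.
split; first by apply: mul_cvg; [exact: cvg_id|exact: cvg_cst].
move=> c c' ac ac' cg chg; pose d := chart_at h.
have M := chart_mul_C2 ac (chart_at_atlas h) ac' cg (chart_at_dom h) chg.
pose i (u : E) := (u, cmap d h).
have [|||i1 _] := @C1_affine _ _ _ (hausdorff_prod hE hE) i (fun u => (u, 0)) (cmap c g).
- by move=> u; apply: cvg_pair; [exact: cvg_id|exact: cvg_cst].
- by move=> u; apply: cvg_pair; [exact: cvg_id|exact: cvg_cst].
- by move=> u v t; congr pair; rewrite /= scaler0 addr0.
have [+ _] := @C1_comp _ _ _ _ hE i (chart_mul c d c') (cmap c g) i1 M.1.
by apply: (C1_near_ext hE); apply: nearW => u; rewrite /chart_mul /i /d /= cmapK.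
Qed.

Lemma C1_map_conj h g : C1_map (fun k => h * k * h^-1)%g g.
Proof. exact: C1_map_comp (C1_map_lmul h g) (C1_map_rmul _ _). Qed.

Lemma C1_map_id (g : G) : C1_map id g.
Proof.
have := C1_map_lmul 1%g g.
by rewrite (_ : (fun k : G => 1 * k)%g = id)//; apply/funext => k; rewrite mul1g.
Qed.

Lemma hasvel_map c c' f mu t v : C1_map f (mu t) -> atlas c -> atlas c' ->
  hasvel c mu t v -> cdom c' (f (mu t)) ->
  hasvel c' (fun s => f (mu s)) t
    (dir_derive (fun u => cmap c' (f (cinv c u))) (cmap c (mu t)) v).
Proof.
move=> [fc f1] ac ac' hm cf; have [dm cm vm] := hm.
split=> //; first exact: (cvg_at fc cm).
apply: curve_deriv_near (curve_deriv_comp (f1 c c' ac ac' dm cf) vm).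
by apply: filterS (hasvel_near_dom hm) => s ms; rewrite cmapK.
Qed.

End Charts.
#[global] Hint Resolve chart_at_atlas chart_at_dom : core.

(** * The adjoint action *)

Section Adjoint.
Context {R : realType} {E : tvsType R} (hE : hausdorff_space E) {G : milnorLieType E}.
Implicit Types (c : chart E G) (mu nu : R -> G) (g h : G) (t : R) (v w X Y : E).

Notation c0 := (chart_at (1%g : G)).
Notation u0 := (cmap c0 1%g).

Lemma AdE h Y : Ad h Y = dir_derive (fun u => cmap c0 (h * cinv c0 u * h^-1)%g) u0 Y.
Proof. by rewrite /Ad /tmap mulg1 mulgV. Qed.

Lemma hasvel_conj mu t h Y : mu t = 1%g -> hasvel c0 mu t Y ->
  hasvel c0 (fun s => h * mu s * h^-1)%g t (Ad h Y).
Proof.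
move=> m1 hm; rewrite AdE -m1.
have := @hasvel_map _ _ _ c0 c0 (fun k => h * k * h^-1)%g mu t Y.
rewrite m1; apply=> //; first exact: C1_map_conj.
by rewrite mulg1 mulgV.
Qed.

Lemma conj_chart_C1 h : C1_near (fun u => cmap c0 (h * cinv c0 u * h^-1)%g) u0.
Proof.
have [_ h1] := C1_map_conj hE h (1%g : G); apply: h1 => //.
by rewrite mulg1 mulgV.
Qed.

Lemma AdD h X Y : Ad h (X + Y) = Ad h X + Ad h Y.
Proof. by rewrite !AdE dir_deriveD//; exact: conj_chart_C1. Qed.

Lemma AdZ h (k : R) X : Ad h (k *: X) = k *: Ad h X.
Proof. by rewrite !AdE dir_deriveZ//; exact: C1_near_at (conj_chart_C1 _). Qed.

Lemma AdN h X : Ad h (- X) = - Ad h X.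
Proof. by rewrite -scaleN1r AdZ scaleN1r. Qed.

Lemma AdB h X Y : Ad h (X - Y) = Ad h X - Ad h Y.
Proof. by rewrite AdD AdN. Qed.

Lemma Ad_continuous h : continuous (Ad h : E -> E).
Proof.
move=> Y; have [_ /(_ Y)[_ cc]] := C1_near_at (conj_chart_C1 h).
have q : (u0, Z) @[Z --> Y] --> (u0, Y) by apply: cvg_pair; [exact: cvg_cst|exact: cvg_id].
by rewrite /continuous_at AdE; apply: cvg_ext (cvg_at cc q) => Z; rewrite AdE.
Qed.

(** Both sides are the velocity of the same conjugate of [line]. *)
Lemma AdM g h Y : Ad (g * h)%g Y = Ad g (Ad h Y).
Proof.
have hY := hasvel_line Y (chart_at_dom (1%g : G)).
have l1 := line0 Y (chart_at_dom (1%g : G)).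
have h1 := hasvel_conj h l1 hY.
have m1 : (h * line c0 1%g Y 0 * h^-1 = 1)%g by rewrite l1 mulg1 mulgV.
have h2 := hasvel_conj g m1 h1.
apply: (hasvel_unique hE (hasvel_conj (g * h)%g l1 hY)).
congr (hasvel _ _ _ _): h2; apply/funext => s.
by rewrite invgM !mulgA.
Qed.

Lemma Ad1 Y : Ad (1%g : G) Y = Y.
Proof.
have hY := hasvel_line Y (chart_at_dom (1%g : G)).
have l1 := line0 Y (chart_at_dom (1%g : G)).
apply: (hasvel_unique hE (hasvel_conj 1%g l1 hY)).
by congr (hasvel _ _ _ _): hY; apply/funext => s; rewrite invg1 mulg1 mul1g.
Qed.

Notation M := (chart_mul c0 c0 c0).

Lemma chart_mul1_C2 : C2_near M (u0, u0).
Proof. by apply: chart_mul_C2 => //; rewrite mulg1. Qed.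

(** Multiplying a curve by the unit changes neither the curve nor its velocity. *)
Lemma chart_mul1_l v : dir_derive M (u0, u0) (v, 0) = v.
Proof.
have hl := hasvel_line v (chart_at_dom (1%g : G)).
have l1 := line0 v (chart_at_dom (1%g : G)).
have h1 := hasvel_cst 0 (chart_at_dom (1%g : G)).
have := hasvel_mul hE (chart_at_atlas _) (chart_at_atlas _) (chart_at_atlas (1%g : G)) hl h1.
rewrite l1 mulg1 => /(_ (chart_at_dom _)); under eq_fun do rewrite mulg1.
by move/(hasvel_unique hE); apply.
Qed.

Lemma chart_mul1_r v : dir_derive M (u0, u0) (0, v) = v.
Proof.
have hl := hasvel_line v (chart_at_dom (1%g : G)).
have l1 := line0 v (chart_at_dom (1%g : G)).
have h1 := hasvel_cst 0 (chart_at_dom (1%g : G)).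
have := hasvel_mul hE (chart_at_atlas _) (chart_at_atlas _) (chart_at_atlas (1%g : G)) h1 hl.
rewrite l1 mul1g => /(_ (chart_at_dom _)); under eq_fun do rewrite mul1g.
by move/(hasvel_unique hE); apply.
Qed.

Lemma hasvel_mul1 mu nu t v w : mu t = 1%g -> nu t = 1%g ->
  hasvel c0 mu t v -> hasvel c0 nu t w -> hasvel c0 (fun s => mu s * nu s)%g t (v + w).
Proof.
move=> m1 n1 hm hn.
have := hasvel_mul hE (chart_at_atlas _) (chart_at_atlas _) (chart_at_atlas (1%g : G)) hm hn.
rewrite m1 n1 mulg1 => /(_ (chart_at_dom _)).
have -> : (v, w) = (v, 0) + (0, w) :> E * E by congr pair; rewrite /= ?addr0 ?add0r.
by rewrite dir_deriveD ?chart_mul1_l ?chart_mul1_r//; exact: chart_mul1_C2.1.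
Qed.

(** The curve mu mu^-1 is constant, and velocities at the unit add up. *)
Lemma hasvel_inv1 mu t v : mu t = 1%g -> hasvel c0 mu t v ->
  hasvel c0 (fun s => (mu s)^-1)%g t (- v).
Proof.
move=> m1 hm.
have hi : hasvel c0 (fun s => (mu s)^-1)%g t (dir_derive (chart_inv c0 c0) u0 v).
  have := hasvel_inv hE (chart_at_atlas _) (chart_at_atlas (1%g : G)) hm.
  by rewrite m1 invg1; exact.
have i1 : ((mu t)^-1 = 1)%g by rewrite m1 invg1.
have := hasvel_mul1 m1 i1 hm hi.
under eq_fun do rewrite mulgV.
move/(hasvel_unique hE (hasvel_cst t (chart_at_dom (1%g : G)))) => h0.
suff -> : - v = dir_derive (chart_inv c0 c0) u0 v by [].
by apply/eqP; rewrite eq_sym -addr_eq0 addrC -h0.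
Qed.

(** With m the multiplication in the chart at the unit and w the coordinate of h,
    this is Ad_h Y = d R_(h^-1) (d L_h Y), both differentials being
    partial derivatives of m. *)
Definition Ad_chart (z : E * E) : E :=
  dir_derive M (z.1, chart_inv c0 c0 z.1) (dir_derive M (z.1, u0) (0, z.2), 0).

(** A curve through the unit with velocity Y is translated by h from the left, then
    by h^-1 from the right. *)
Lemma Ad_chartE : \forall w \near u0, forall Y,
  Ad (cinv c0 w) Y = Ad_chart (w, Y).
Proof.
have q := cinv_cont (cmap_cod (chart_at_dom (1%g : G))).
rewrite /prop_for /continuous_at cmapK// in q.
have n2 : \forall w \near u0, cdom c0 (cinv c0 w)^-1%g.
  apply: (inv_cvg q); apply: cdom_nbhs; rewrite invg1; exact: chart_at_dom.
apply: filterS2 (ccod_nbhs (cmap_cod (chart_at_dom (1%g : G)))) n2 => w cw dw Y.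
have dcw := cinv_dom cw.
have hl := hasvel_line Y (chart_at_dom (1%g : G)).
have l1 := line0 Y (chart_at_dom (1%g : G)).
have h1 := hasvel_cst 0 dcw.
have := hasvel_mul hE (chart_at_atlas _) (chart_at_atlas _) (chart_at_atlas (1%g : G)) h1 hl.
rewrite l1 mulg1 cinvK// => /(_ dcw) h2.
have h3 := hasvel_cst 0 dw.
have := hasvel_mul hE (chart_at_atlas _) (chart_at_atlas _) (chart_at_atlas (1%g : G)) h2 h3.
rewrite l1 mulg1 mulgV cinvK// => /(_ (chart_at_dom _)) h4.
exact: (hasvel_unique hE (hasvel_conj _ l1 hl) h4).
Qed.

(** Up to the inversion, [Ad_chart] is composed of tangent maps of the
    multiplication; these are C1 because the multiplication is C2. *)
Lemma Ad_chart_C1 Y : C1_near Ad_chart (u0, Y).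
Proof.
have hEE := hausdorff_prod hE hE.
have f1 : C1_near (fst : E * E -> E) (u0, Y).
  by have [|||] := @C1_affine _ _ _ hE (fst : E * E -> E) fst (u0, Y) => // z; exact: cvg_fst.
have s1 : C1_near (snd : E * E -> E) (u0, Y).
  by have [|||] := @C1_affine _ _ _ hE (snd : E * E -> E) snd (u0, Y) => // z; exact: cvg_snd.
have k1 (a : E) : C1_near (fun _ : E * E => a) (u0, Y).
  have [|||] // := @C1_affine _ _ _ hE (fun _ : E * E => a) (fun=> 0) (u0, Y).
  - by move=> z; exact: cvg_cst.
  - by move=> z; exact: cvg_cst.
  - by move=> *; rewrite scaler0 addr0.
have i1 : C1_near (chart_inv c0 c0) u0.
  by apply: chart_inv_C1 => //; rewrite invg1.
have [if1 _] := @C1_comp _ _ _ _ hE (fst : E * E -> E) (chart_inv c0 c0) (u0, Y) f1 i1.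
have [fu _] := C1_pair hE hE f1 (k1 u0).
have [zs _] := C1_pair hE hE (k1 0) s1.
have [fuzs _] := C1_pair hEE hEE fu zs.
have T (v : E * E) := C1_tangent hE v chart_mul1_C2.
have [a1 _] := @C1_comp _ _ _ _ hE _ (fun z : E * E * (E * E) => dir_derive M z.1 z.2) _ fuzs (T _).
have [a2 _] := C1_pair hE hE a1 (k1 0).
have [a3 _] := C1_pair hE hE f1 if1.
have [a4 _] := C1_pair hEE hEE a3 a2.
have iu : chart_inv c0 c0 u0 = u0 by rewrite /chart_inv cmapK// invg1.
have Ta (v : E * E) : C1_near (fun z : E * E * (E * E) => dir_derive M z.1 z.2)
    ((u0, chart_inv c0 c0 u0), v) by rewrite iu.
by have [] := @C1_comp _ _ _ _ hE _ (fun z : E * E * (E * E) => dir_derive M z.1 z.2) _ a4 (Ta _).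
Qed.

Lemma Ad_cinv_C1 Y : C1_near (fun w => Ad (cinv c0 w) Y) u0.
Proof.
have hEE := hausdorff_prod hE hE.
have [|||i1 _] := @C1_affine _ _ _ hEE (fun w => (w, Y)) (fun w => (w, 0)) u0.
- by move=> u; apply: cvg_pair; [exact: cvg_id|exact: cvg_cst].
- by move=> u; apply: cvg_pair; [exact: cvg_id|exact: cvg_cst].
- by move=> u v t; congr pair; rewrite /= scaler0 addr0.
have [+ _] := @C1_comp _ _ _ _ hE _ Ad_chart u0 i1 (Ad_chart_C1 Y).
by apply: (C1_near_ext hE); apply: filterS Ad_chartE => w ->.
Qed.

Lemma Ad_cinv_continuous Y :
  {for (u0, Y), continuous (fun z : E * E => Ad (cinv c0 z.1) z.2)}.
Proof.
have [c _] := C1_near_at (Ad_chart_C1 Y).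
have e1 := nbhs_singleton Ad_chartE.
rewrite /prop_for /continuous_at /= e1.
apply: cvg_trans c; apply: near_eq_cvg.
by apply: filterS (near_fst Y Ad_chartE) => -[w Z] /= ->.
Qed.

End Adjoint.

(** * Right logarithmic derivatives *)

Section RightVelocity.
Context {R : realType} {E : tvsType R} (hE : hausdorff_space E) {G : milnorLieType E}.
Implicit Types (c : chart E G) (mu nu : R -> G) (g h : G) (t : R) (v w X Y : E).

Notation c0 := (chart_at (1%g : G)).
Notation u0 := (cmap c0 1%g).

(** The right logarithmic derivative as the velocity at the unit of a translated
    curve, which spares the tangent spaces at other points; it agrees with
    [rlog_derive] by [rlog_deriveE] and [rvel_rlog]. *)
Definition rvel mu t X : Prop := hasvel c0 (fun s => mu s * (mu t)^-1)%g t X.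

Lemma rvel_continuous mu t X : rvel mu t X -> {for t, continuous mu}.
Proof.
move=> [_ h _].
have := mul_cvg h (cvg_cst (mu t)); rewrite mulgVK.
by move=> q; apply: cvg_ext (q _ _) => s; rewrite mulgVK.
Qed.

Lemma rvel_unique mu t X Y : rvel mu t X -> rvel mu t Y -> X = Y.
Proof. exact: hasvel_unique. Qed.

Lemma rvel_cst g t : rvel (fun=> g) t 0.
Proof. by rewrite /rvel mulgV; apply: hasvel_cst. Qed.

Lemma rvel_hasvel c mu t X : atlas c -> cdom c (mu t) -> rvel mu t X ->
  hasvel c mu t (dir_derive (chart_mul c0 c c) (u0, cmap c (mu t)) (X, 0)).
Proof.
move=> ac cm h.
have hc := hasvel_cst t cm.
have := hasvel_mul hE (chart_at_atlas _) ac ac h hc.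
rewrite mulgV mul1g => /(_ cm).
by congr (hasvel _ _ _ _); apply/funext => s; rewrite mulgVK.
Qed.

Lemma rlog_deriveE mu t v : hasvel (chart_at (mu t)) mu t v ->
  rvel mu t (rlog_derive mu t).
Proof.
move=> h; have [_ _ hv] := h.
have vE : velocity mu t = v.
  rewrite /velocity; apply: dir_deriveP => //.
  by rewrite -(curve_derivE (fun s => cmap (chart_at (mu t)) (mu s))).
rewrite /rvel /rlog_derive /tmap vE mulgV.
apply: (@hasvel_map _ _ _ (chart_at (mu t)) c0 (fun k => k * (mu t)^-1)%g) => //.
  exact: C1_map_rmul.
by rewrite mulgV.
Qed.

Lemma rvel_rlog mu t X : rvel mu t X -> rlog_derive mu t = X.
Proof.
move=> h; have h' := rvel_hasvel (chart_at_atlas (mu t)) (chart_at_dom (mu t)) h.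
exact: rvel_unique (rlog_deriveE h') h.
Qed.

(** mu(s) nu(s) (mu(t) nu(t))^-1 is the product of mu(s) mu(t)^-1 and of the conjugate
    of nu(s) nu(t)^-1 by mu(t). *)
Lemma rvel_mul mu nu t X Y : rvel mu t X -> rvel nu t Y ->
  rvel (fun s => mu s * nu s)%g t (X + Ad (mu t) Y).
Proof.
move=> hm hn.
have := hasvel_mul1 hE _ _ hm (hasvel_conj hE (mu t) _ hn).
rewrite !mulgV mulg1 mulgV => /(_ erefl erefl erefl).
congr (hasvel _ _ _ _); apply/funext => s.
by rewrite invgM !mulgA mulgVK.
Qed.

Lemma rvel_inv mu t X : rvel mu t X -> rvel (fun s => (mu s)^-1)%g t (- Ad (mu t)^-1%g X).
Proof.
move=> hm.
have := hasvel_conj hE (mu t)^-1%g _ (hasvel_inv1 hE _ hm).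
rewrite !mulgV invg1 => /(_ erefl erefl); rewrite AdN//.
congr (hasvel _ _ _ _); apply/funext => s.
by rewrite invgM !invgK mulgA mulVg mul1g.
Qed.

Lemma rvel_div mu nu t X Y : rvel nu t X -> rvel mu t Y ->
  rvel (fun s => (nu s)^-1 * mu s)%g t (Ad (nu t)^-1%g (Y - X)).
Proof.
move=> hn hm; have := rvel_mul (rvel_inv hn) hm.
by rewrite AdB// addrC.
Qed.

Lemma rvel_rmul mu t X g : rvel mu t X -> rvel (fun s => mu s * g)%g t X.
Proof. by move=> h; have := rvel_mul h (rvel_cst g t); rewrite -(scale0r 0) AdZ// scale0r addr0. Qed.

Lemma rvel_affine mu (a k : R) t X : rvel mu (a + k * t) X ->
  rvel (fun s => mu (a + k * s)) t (k *: X).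
Proof.
move=> [d c h]; split => //; last exact: curve_deriv_affine h.
have q : a + k * s @[s --> t] --> a + k * t.
  by apply: cvgD; [exact: cvg_cst|apply: cvgM; [exact: cvg_cst|exact: cvg_id]].
exact: (cvg_at (f := fun s => a + k * s) c q).
Qed.

Lemma lie_Ck_rvel (J : set R) mu t : open J -> J t -> lie_Ck 1 J mu ->
  rvel mu t (rlog_derive mu t).
Proof.
move=> oJ Jt [cm dm].
have mc : {for t, continuous mu}.
  by apply: (within_nbhs_continuous (A := J)) => //; exact: open_nbhs_nbhs.
have [d _] := dm _ (chart_at_atlas (mu t)).
have [l hl] := d [::] (1 : R^o) t isT (conj Jt (chart_at_dom (mu t))).
apply: (@rlog_deriveE _ _ l); split => //.
by rewrite (curve_derivE (fun s => cmap (chart_at (mu t)) (mu s))).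
Qed.

Section CurveCk.
Variables (k : nat) (U : set R) (F : nat -> R -> E).
Hypotheses (oU : open U)
  (dF : forall i t, (i < k)%N -> U t -> curve_deriv (F i) t (F i.+1 t))
  (cF : forall i t, (i <= k)%N -> U t -> {for t, continuous (F i)}).

Let has_deriv_curve i (t v : R^o) : (i < k)%N -> U t ->
  has_deriv (F i : R^o -> E) t v ((v : R) *: F i.+1 t).
Proof.
move=> ik Ut; have df : curve_deriv (F i) (t + v * 0) (F i.+1 t).
  by rewrite mulr0 addr0; exact: dF.
rewrite has_derivE; apply: cvg_ext (curve_deriv_affine df) => h.
by rewrite add0r mulr0 scale0r [h *: v]mulrC.
Qed.

Let has_deriv_scaled i (f : R^o -> E) (a : R) (t v : R^o) :
  (forall t, U t -> f t = a *: F i t) -> (i < k)%N -> U t ->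
  has_deriv f t v ((a * v) *: F i.+1 t).
Proof.
move=> fE ik Ut.
have h : has_deriv (fun s : R^o => a *: F i s) t v ((a * v) *: F i.+1 t).
  have := @has_deriv_curve i t v ik Ut; rewrite !has_derivE -scalerA => h.
  exact: curve_derivZ h.
apply: has_deriv_near h.
by apply: filterS (open_nbhs_nbhs (conj oU Ut)) => s Us; rewrite fE.
Qed.

Let iter_derive_curve (vs : seq R^o) : forall i (f : R^o -> E) (a : R),
  (forall t, U t -> f t = a *: F i t) -> (i + size vs <= k)%N ->
  forall t, U t -> iter_derive f vs t = (a * \prod_(v <- vs) (v : R)) *: F (i + size vs)%N t.
Proof.
elim: vs => [|v vs IH] i f a fE ik t Ut /=.
  by rewrite big_nil mulr1 addn0 fE.
rewrite big_cons mulrA -addSnnS; apply: IH => //; last by rewrite addSnnS.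
move=> s Us; apply: (dir_deriveP hE); apply: (@has_deriv_scaled i f a s v fE) => //.
by apply: leq_trans ik; rewrite /= -addSnnS leq_addr.
Qed.

(** Directional derivatives of a curve are multiples of its derivative, so that a
    chain F of successive derivatives describes all the iterated ones. *)
Lemma curve_Ck : Ck k (U : set R^o) (F 0%N : R^o -> E).
Proof.
have FE t : U t -> F 0%N t = 1 *: F 0%N t by rewrite scale1r.
split=> [vs v t vsk Ut|p pk].
  exists (((1 * \prod_(v <- vs) (v : R)) * v) *: F (size vs).+1 t).
  apply: (@has_deriv_scaled (size vs)) => // s Us.
  by rewrite (@iter_derive_curve _ 0%N _ 1)// ltnW.
apply: continuous_in_subspaceT => -[t r]; rewrite inE => -[/= Ut _].
have pf : z.1 @[z --> (t, r)] --> t by exact: cvg_fst.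
have pE (z : R^o * 'rV[R^o]_p) : U z.1 ->
    iter_derive (F 0%N : R^o -> E) [seq z.2 ord0 i | i <- enum 'I_p] z.1 =
    (\prod_(i <- enum 'I_p) (z.2 ord0 i : R)) *: F p z.1.
  move=> Uz; rewrite (@iter_derive_curve _ 0%N _ 1)//.
    by rewrite mul1r big_map size_map size_enum_ord.
  by rewrite size_map size_enum_ord.
have cp (s : seq 'I_p) : (fun z : R^o * 'rV[R^o]_p => \prod_(i <- s) (z.2 ord0 i : R)) @ nbhs (t, r) -->
    \prod_(i <- s) (r ord0 i : R).
  elim: s => [|i s IH]; first by under eq_fun do rewrite big_nil; rewrite big_nil; exact: cvg_cst.
  under eq_fun do rewrite big_cons; rewrite big_cons; apply: cvgM => //.
  have ps : z.2 @[z --> (t, r)] --> r by exact: cvg_snd.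
  move=> A Ai; apply: (ps [set m | A (m ord0 i)]).
  exists (fun _ j => if j == i then A else setT) => [j1 j|m hm /=].
    by rewrite (ord1 j1); case: eqP => [->|_] //; exact: filterT.
  by have := hm ord0 i; rewrite eqxx.
rewrite /prop_for /continuous_at pE//=.
apply: cvg_trans (tvs_cvgZ (cp (enum 'I_p)) (cvg_at (cF pk Ut) pf)).
apply: near_eq_cvg.
have : \forall z \near (t, r), U z.1 by apply: pf; exact: open_nbhs_nbhs.
by apply: filterS => z Uz; rewrite pE.
Qed.

End CurveCk.

(** In a chart, the velocity of mu at t is obtained from (phi t, 0) by the tangent map
    of the multiplication, hence is continuous in t. *)
Lemma rvel_lie_Ck (J : set R) mu (phi : R -> E) : open J ->
  (forall t, J t -> rvel mu t (phi t)) ->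
  (forall t, J t -> {for t, continuous phi}) -> lie_Ck 1 J mu.
Proof.
move=> oJ hm cp.
have cm t : J t -> {for t, continuous mu} by move=> Jt; exact: rvel_continuous (hm t Jt).
split; first by apply: continuous_in_subspaceT => t; rewrite inE; exact: cm.
move=> c ac.
pose F (i : nat) t : E := if i is 0%N then cmap c (mu t) else
  dir_derive (chart_mul c0 c c) (u0, cmap c (mu t)) (phi t, 0).
have oJc : open (J `&` mu @^-1` cdom c).
  rewrite openE => t [Jt ct]; apply: filterI; first exact: open_nbhs_nbhs.
  exact: (cm t Jt _ (cdom_nbhs ct)).
apply: (@curve_Ck 1 (J `&` mu @^-1` cdom c) F oJc) => [[|//] t _ [Jt ct]|i t i1 [Jt ct]].
  by have [_ _] := rvel_hasvel ac ct (hm t Jt).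
case: i i1 => [|[|//]] _.
  have [_ _ h] := rvel_hasvel ac ct (hm t Jt); exact: curve_deriv_cont h.
have cmt := cvg_at (cmap_cont ct) (cm t Jt).
have d0 : cdom c (1 * mu t)%g by rewrite mul1g.
have [M1 _] := chart_mul_C2 hE (chart_at_atlas (1%g : G)) ac ac (chart_at_dom _) ct d0.
have [_ /(_ (phi t, 0))[_ cD]] := C1_near_at M1.
have q : ((u0, cmap c (mu s)), (phi s, 0 : E)) @[s --> t] --> ((u0, cmap c (mu t)), (phi t, 0 : E)).
  have q1 : (u0, cmap c (mu s)) @[s --> t] --> (u0, cmap c (mu t)).
    by apply: cvg_pair => //; exact: cvg_cst.
  have q2 : (phi s, 0 : E) @[s --> t] --> (phi t, 0 : E).
    by apply: cvg_pair; [exact: cp|exact: cvg_cst].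
  exact: (cvg_pair q1 q2).
exact: (cvg_at cD q).
Qed.

End RightVelocity.

(** * Evolutions and exponential curves *)

Section Evolution.
Context {R : realType} {E : tvsType R} (hE : hausdorff_space E) {G : milnorLieType E}.
Implicit Types (c : chart E G) (mu nu : R -> G) (g h : G) (t : R) (v w X Y : E).

(** In a chart the velocity vanishes, and the mean value inequality applies to all
    seminorms along the segment from t to s. *)
Lemma rvel0_locally_const mu t : (forall s, 0 <= s <= 1 -> rvel mu s 0) ->
  0 <= t <= 1 -> \forall s \near t, 0 <= s <= 1 -> mu s = mu t.
Proof.
move=> h0 t01; pose c := chart_at (mu t).
have ct : cdom c (mu t) := chart_at_dom (mu t).
have := rvel_continuous (h0 t t01) (cdom_nbhs ct).
move=> /nbhs_ballP[d /= d0 hd].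
apply/nbhs_ballP; exists d => // s st s01.
have seg th : 0 <= th <= 1 -> 0 <= t + (s - t) * th <= 1 /\ cdom c (mu (t + (s - t) * th)).
  move=> /andP[th0 th1]; split.
    have -> : t + (s - t) * th = t * (1 - th) + s * th by ring.
    case/andP: t01 => t0 t1; case/andP: s01 => s0 s1.
    have th2 : 0 <= 1 - th by lra.
    have a1 := mulr_ge0 t0 th2; have a2 := mulr_ge0 s0 th0.
    have a3 : t * (1 - th) <= 1 * (1 - th) by rewrite ler_wpM2r.
    have a4 : s * th <= 1 * th by rewrite ler_wpM2r.
    by apply/andP; split; lra.
  apply: hd; move: st; rewrite /ball /= opprD addrA subrr add0r normrN normrM distrC.
  by apply: le_lt_trans; rewrite ler_piMr// ger0_norm.
have df th : 0 <= th <= 1 -> curve_deriv (fun th => cmap c (mu (t + (s - t) * th))) th 0.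
  move=> /seg[k01 ck]; rewrite -(scaler0 _ (s - t)).
  apply: (@curve_deriv_affine _ _ (fun r => cmap c (mu r))).
  have [_ _] := rvel_hasvel hE (chart_at_atlas (mu t)) ck (h0 _ k01).
  rewrite (dir_derive0 hE)//.
  have d0' : cdom c (1 * mu (t + (s - t) * th)%R)%g by rewrite mul1g.
  have [M1 _] := chart_mul_C2 hE (chart_at_atlas (1%g : G)) (chart_at_atlas (mu t))
    (chart_at_atlas (mu t)) (chart_at_dom _) ck d0'.
  exact: C1_near_at M1.
have fE : cmap c (mu (t + (s - t) * 1)) - cmap c (mu (t + (s - t) * 0)) = 0.
  apply: (seminorm_separates hE) => p hp; apply/eqP; rewrite eq_le seminorm_ge0// andbT.
  have := @mean_value _ _ p (fun th => cmap c (mu (t + (s - t) * th))) (fun=> 0)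
    (fun=> 0) (fun=> 0) 0 1 hp ler01 df.
  rewrite subrr; apply=> [r _|r _]; first exact: curve_deriv_cst.
  by rewrite seminorm0.
move/eqP: fE; rewrite subr_eq0 mulr1 mulr0 addr0 addrC subrK => /eqP fE.
rewrite -(cmapK ct) -fE cmapK//.
by apply: hd.
Qed.

(** Being locally constant, mu is constant on the connected interval [0, 1]. *)
Lemma rvel0_const mu : (forall t, 0 <= t <= 1 -> rvel mu t 0) -> mu 1 = mu 0.
Proof.
move=> h0; have loc t := rvel0_locally_const h0 (t := t).
pose B := [set t | 0 <= t <= 1 /\ mu t = mu 0].
suff : B = `[(0 : R), 1]%classic.
  move=> BE; have : B 1 by rewrite BE /= in_itv /= ler01 lexx.
  by case.
have t0 : 0 <= (0 : R) <= 1 by rewrite lexx ler01.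
apply: (@segment_connected R 0 1).
- by exists 0; split.
- exists [set t | 0 <= t <= 1 -> mu t = mu 0]°; first exact: open_interior.
  apply/seteqP; split=> t /=.
    move=> [t01 mt]; split; first by rewrite in_itv.
    by apply: filterS (loc t t01) => s + s01; rewrite -mt; apply.
  by rewrite in_itv /= => -[t01 /nbhs_singleton h]; split=> //; exact: h.
- exists (~` [set t | 0 <= t <= 1 -> mu t <> mu 0]°).
    by apply: open_closedC; exact: open_interior.
  apply/seteqP; split=> t /=.
    move=> [t01 mt]; split; first by rewrite in_itv.
    by move/nbhs_singleton => /(_ t01).
  rewrite in_itv /= => -[t01 ht]; split=> //; apply: contrapT => mt; apply: ht.
  by apply: filterS (loc t t01) => s h s01; rewrite h.
Qed.

Lemma rlog_on_rvel mu (phi : R -> E) t : rlog_on 0 1 mu phi -> 0 <= t <= 1 ->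
  rvel mu t (phi t).
Proof.
move=> [[a [b [a0 b1 hm]]] hphi] t01; rewrite -hphi//.
apply: (lie_Ck_rvel hE _ _ hm); first exact: interval_open.
by rewrite /= in_itv /=; case/andP: t01 => ? ?; apply/andP; split; lra.
Qed.

Lemma rvel_rlog_on mu (phi : R -> E) (a b : R) : a < 0 -> 1 < b ->
  (forall t, a < t < b -> rvel mu t (phi t) /\ {for t, continuous phi}) ->
  rlog_on 0 1 mu phi.
Proof.
move=> a0 b1 h; split.
  exists a, b; split=> //; apply: (rvel_lie_Ck hE (phi := phi)).
  - exact: interval_open.
  - by move=> t; rewrite /= in_itv /= => /h[].
  - by move=> t; rewrite /= in_itv /= => /h[].
move=> t /andP[t0 t1]; apply: (rvel_rlog hE); apply: (h t _).1.
by apply/andP; split; lra.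
Qed.

(** If mu and nu solve the same equation, then nu^-1 mu has right logarithmic derivative
    0, hence is constant: the choice made by [evol] is irrelevant. *)
Lemma evolE mu (phi : R -> E) : rlog_on 0 1 mu phi ->
  evol 0 1 phi = (mu 1%R * (mu 0%R)^-1)%g.
Proof.
move=> hm; rewrite /evol.
case: xgetP => [g gE [nu hn ->]|/(_ (mu 1%R * (mu 0%R)^-1)%g) []]; last by exists mu.
have : ((nu 1%R)^-1 * mu 1%R = (nu 0%R)^-1 * mu 0%R)%g.
  apply: (rvel0_const (mu := fun s => (nu s)^-1 * mu s)%g) => t t01.
  have := rvel_div hE (rlog_on_rvel hn t01) (rlog_on_rvel hm t01).
  by rewrite subrr -(scale0r 0) AdZ// !scale0r.
move/(congr1 (fun g => nu 1%R * g * (mu 0%R)^-1)%g).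
by rewrite !mulgA mulgV mul1g mulgK.
Qed.

Lemma smooth_cst (X : E) : @smooth_on R E G 0 1 (fun=> X).
Proof.
exists (-1), 2; split; [by rewrite oppr_lt0|by rewrite ltr1n|move=> k].
pose F (i : nat) : R -> E := if i is 0%N then fun=> X else fun=> 0.
apply: (curve_Ck hE (F := F)); first exact: interval_open.
  by move=> [|i] t _ _; exact: curve_deriv_cst.
by move=> [|i] t _ _; exact: cvg_cst.
Qed.

Hypothesis G_semiregular : semiregular G.

(** Semiregularity yields a solution of the equation on [0, 1] only.  Solving it
    for 4 X and rescaling [0, 1] to [-2, 2] gives a curve that solves the equation for X on
    a neighborhood of [0, 1]. *)
Lemma exp_curve X : exists nu : R -> G,
  [/\ nu 0 = 1%g, nu 1 = lie_exp X & forall t, - 2 < t < 2 -> rvel nu t X].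
Proof.
have : @Dinfty R E G 0 1 (fun=> 4 *: X) by rewrite G_semiregular; exact: smooth_cst.
move=> [_ [mu hmu]].
pose nu s := (mu (2^-1 + 4^-1 * s)%R * (mu (2^-1)%R)^-1)%g.
have nu0 : nu 0 = 1%g by rewrite /nu mulr0 addr0 mulgV.
have hnu t : - 2 < t < 2 -> rvel nu t X.
  move=> /andP[t0 t1].
  have k01 : 0 <= 2^-1 + 4^-1 * t <= 1 by apply/andP; split; lra.
  have := rvel_rmul hE (mu (2^-1)%R)^-1%g (rvel_affine (rlog_on_rvel hmu k01)).
  by rewrite scalerA mulVf ?scale1r// pnatr_eq0.
exists nu; split => //.
have : rlog_on 0 1 nu (fun=> X).
  apply: (@rvel_rlog_on _ _ (-2) 2).
  - by rewrite oppr_lt0.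
  - by rewrite ltr1n.
  - by move=> t ht; split; [exact: hnu|exact: cvg_cst].
by move/evolE; rewrite /lie_exp nu0 invg1 mulg1.
Qed.

End Evolution.

(** * The adjoint action along an exponential curve *)

Section AdjointCurve.
Context {R : realType} {E : tvsType R} (hE : hausdorff_space E) {G : milnorLieType E}.
Implicit Types (t : R) (Y Z : E).

Notation c0 := (chart_at (1%g : G)).
Notation u0 := (cmap c0 1%g).

Variables (X : E) (nu : R -> G).
Hypotheses (nu0 : nu 0 = 1%g) (hnu : forall t, - 2 < t < 2 -> rvel nu t X).

(** For nu t = exp(t X), this is Ad(exp(- t X)). *)
Definition Adc t Z : E := Ad (nu t)^-1%g Z.
Definition adN : E -> E := bracket (G := G) (- X).

Lemma Adc0 Z : Adc 0 Z = Z.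
Proof. by rewrite /Adc nu0 invg1 (Ad1 hE). Qed.

Let beta t s := (nu t * (nu s)^-1)%g.

Let AdcE t s Z : Adc s Z = Adc t (Ad (beta t s) Z).
Proof. by rewrite /Adc -AdM// /beta mulKg. Qed.

Let hasvel_beta t : - 2 < t < 2 -> hasvel c0 (beta t) t (- X).
Proof.
move=> ht; have h := hnu ht.
have := hasvel_inv1 hE _ h; rewrite mulgV => /(_ erefl).
by congr (hasvel _ _ _ _); apply/funext => s; rewrite invgM invgK.
Qed.

(** Near t, Ad(nu(s)^-1) = Ad(nu(t)^-1) Ad(beta(s)) with beta(s) = nu(t) nu(s)^-1, a
    curve through the unit with velocity - X at s = t; the bracket is the derivative of
    Ad at the unit. *)
Lemma Adc_deriv t Z : - 2 < t < 2 -> curve_deriv (fun s => Adc s Z) t (Adc t (adN Z)).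
Proof.
move=> ht; have hb := hasvel_beta ht; have [_ _ vb] := hb.
have b1 : cmap c0 (beta t t) = u0 by rewrite /beta mulgV.
have C := Ad_cinv_C1 (G := G) hE Z.
rewrite -b1 in C.
have := curve_deriv_comp C vb; rewrite b1 => dAd.
have {}dAd : curve_deriv (fun s => Ad (beta t s) Z) t (adN Z).
  apply: curve_deriv_near dAd.
  by apply: filterS (hasvel_near_dom hb) => s bs; rewrite cmapK.
apply: cvg_ext (cvg_at (@Ad_continuous _ _ hE G (nu t)^-1%g _) dAd) => h /=.
by rewrite AdZ// AdB// -!/(Adc t _) -!AdcE.
Qed.

Lemma Adc_continuous t Z : - 2 < t < 2 ->
  {for (t, Z), continuous (fun z : R * E => Adc z.1 z.2)}.
Proof.
move=> ht; have hb := hasvel_beta ht; have [bd bc _] := hb.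
have pf : z.1 @[z --> (t, Z)] --> t by exact: cvg_fst.
have ps : z.2 @[z --> (t, Z)] --> Z by exact: cvg_snd.
have b1 : beta t t = 1%g by rewrite /beta mulgV.
have bf := cvg_at bc pf.
have q1 : cmap c0 (beta t z.1) @[z --> (t, Z)] --> u0.
  by have := cvg_at (cmap_cont bd) bf; rewrite b1.
have q : (cmap c0 (beta t z.1), z.2) @[z --> (t, Z)] --> (u0, Z) by exact: cvg_pair.
have q2 := cvg_at (@Ad_cinv_continuous _ _ hE G Z) q.
have := cvg_at (@Ad_continuous _ _ hE G (nu t)^-1%g _) q2.
rewrite /= cmapK// (Ad1 hE) => h; rewrite /prop_for /continuous_at /=.
apply: cvg_trans h; apply: near_eq_cvg.
have : \forall z \near (t, Z), cdom c0 (beta t z.1) by exact: (bf _ (cdom_nbhs bd)).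
by apply: filterS => z bz; rewrite cmapK// (AdcE t).
Qed.

Lemma itv01_in t : 0 <= t <= 1 -> - 2 < t < 2.
Proof. by move=> /andP[? ?]; apply/andP; split; lra. Qed.

(** By compactness of [0, 1], the maps [Adc t] are equicontinuous at 0; a seminorm
    whose unit ball is mapped by all of them into that of p dominates, since they
    are homogeneous. *)
Lemma Adc_bounded p : continuous_seminorm p -> exists2 q : E -> R,
  continuous_seminorm q & forall t Z, 0 <= t <= 1 -> p (Adc t Z) <= q Z.
Proof.
move=> hp.
have Adc_0 t : Adc t 0 = 0 by have := AdZ hE (nu t)^-1%g 0 0; rewrite !scale0r.
have : \forall Z \near (0 : E), forall t, 0 <= t <= 1 -> p (Adc t Z) < 1.
  apply: near_itv01 => t t01.
  have /seminorm_cvgP/(_ p hp 1 ltr01) := @Adc_continuous t 0 (itv01_in t01).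
  rewrite /= Adc_0.
  apply: filterS => -[t' Z] /=.
  by rewrite subr0.
move=> /seminorm_nbhs[q hq qp]; exists q => // t Z t01.
apply/ler_addgt0Pr => e e0; have r0 : 0 < q Z + e by rewrite ltr_wpDl// seminorm_ge0.
have : q ((q Z + e)^-1 *: Z) < 1.
  by rewrite seminormZ// gtr0_norm ?invr_gt0// ltr_pdivrMl// mulr1 ltrDl.
move/qp => /(_ t t01).
by rewrite /Adc AdZ// seminormZ// gtr0_norm ?invr_gt0// ltr_pdivrMl// mulr1 => /ltW.
Qed.

(** The first N terms of the Taylor series of [Adc t Z] at t = 0. *)
Definition expsum (N : nat) t Z : E := \sum_(0 <= i < N) (t ^+ i / i`!%:R) *: iter i adN Z.

(** The primitive of [expsum] that vanishes at t = 0; at t = 1 it is a partial sum of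
    [ad_series]. *)
Definition expsum_int (N : nat) t Z : E :=
  \sum_(0 <= i < N) (t ^+ i.+1 / i.+1`!%:R) *: iter i adN Z.

Lemma expsumS N t Z : expsum N.+1 t Z = Z + expsum_int N t (adN Z).
Proof.
rewrite /expsum big_nat_recl//= expr0 fact0 divr1 scale1r; congr (_ + _).
by apply: eq_bigr => i _; rewrite -iterSr.
Qed.

Lemma expsum_int_deriv N t Z : curve_deriv (fun s => expsum_int N s Z) t (expsum N t Z).
Proof.
apply: (@curve_deriv_sum _ _ N (fun i s => (s ^+ i.+1 / i.+1`!%:R) *: iter i adN Z)
  (fun i => (t ^+ i / i`!%:R) *: iter i adN Z)) => i _.
by apply: curve_deriv_scal; exact: curve_deriv_pow.
Qed.

Lemma expsum_int0 N Z : expsum_int N 0 Z = 0.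
Proof. by rewrite /expsum_int big1// => i _; rewrite expr0n mul0r scale0r. Qed.

(** Induction on N.  Both [Adc t Z] and [expsum N.+1 t Z] start at Z, and their
    derivatives are those of the case N for [adN Z]; integrating the estimate with
    [mean_value] turns t^N / N! into t^(N+1) / (N+1)!. *)
Lemma Adc_taylor p (K : R) N Z : continuous_seminorm p ->
  (forall t, 0 <= t <= 1 -> p (Adc t (iter N adN Z)) <= K) ->
  forall t, 0 <= t <= 1 -> p (Adc t Z - expsum N t Z) <= K * (t ^+ N / N`!%:R).
Proof.
move=> hp; elim: N Z => [|N IH] Z hK t t01.
  by rewrite /expsum big_geq// subr0 expr0 fact0 divr1 mulr1; exact: hK.
have /andP[t0 t1] := t01.
have sub s : 0 <= s <= t -> 0 <= s <= 1.
  by move=> /andP[s0 st]; rewrite s0 (le_trans st).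
have := @mean_value _ _ p (fun s => Adc s Z - expsum N.+1 s Z)
  (fun s => Adc s (adN Z) - expsum N s (adN Z))
  (fun s => K * (s ^+ N.+1 / N.+1`!%:R)) (fun s => K * (s ^+ N / N`!%:R)) 0 t hp t0.
rewrite Adc0 (expsumS N 0) expsum_int0 addr0 subrr subr0 expr0n mul0r mulr0 subr0.
apply=> s /sub s01.
- apply: curve_derivB; first exact: Adc_deriv (itv01_in s01).
  rewrite (_ : (fun s => _) = (fun s => Z + expsum_int N s (adN Z))); last first.
    by apply/funext => r; rewrite expsumS.
  rewrite -[X in curve_deriv _ _ X]add0r; apply: curve_derivD.
    exact: curve_deriv_cst.
  exact: expsum_int_deriv.
- by have h := @curve_derivZ _ R^o K _ _ _ (@curve_deriv_pow R N s); exact: h.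
- by apply: IH => // r r01; rewrite -iterSr; exact: hK.
Qed.

End AdjointCurve.

(** * Constrictedness and convergence of the series *)

Lemma foldr_nseq {A B : Type} (f : A -> B -> B) (z : B) (a : A) (n : nat) :
  foldr f z (nseq n a) = iter n (f a) z.
Proof. by elim: n => //= n ->. Qed.

Section Constricted.
Context {R : realType} {E : tvsType R} (hE : hausdorff_space E) {G : milnorLieType E}.
Implicit Types (t : R) (Y Z : E).

Notation c0 := (chart_at (1%g : G)).
Notation u0 := (cmap c0 1%g).

Variables (Xi : chart E G) (Xi_atlas : atlas Xi) (Xi_dom : cdom Xi 1%g).

Lemma dotpE p Z : dotp Xi p Z = p (dir_derive (fun u => cmap Xi (cinv c0 u)) u0 Z).
Proof. by []. Qed.

Lemma Xi_C1 : C1_near (fun u => cmap Xi (cinv c0 u)) u0.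
Proof. by have [_ h] := C1_map_id hE (1%g : G); exact: h. Qed.

Lemma Xi_C1_inv : C1_near (fun u => cmap c0 (cinv Xi u)) (cmap Xi 1%g).
Proof. by have [_ h] := C1_map_id hE (1%g : G); exact: h. Qed.

(** The two changes of charts are inverse to each other; hence the seminorms
    [dotp Xi p] are cofinal among the continuous ones. *)
Lemma Xi_derivK Z : dir_derive (fun u => cmap c0 (cinv Xi u)) (cmap Xi 1%g)
  (dir_derive (fun u => cmap Xi (cinv c0 u)) u0 Z) = Z.
Proof.
have hl := hasvel_line Z (chart_at_dom (1%g : G)).
have l1 := line0 Z (chart_at_dom (1%g : G)).
have := @hasvel_map _ _ _ c0 Xi id _ _ _ (C1_map_id hE _) (chart_at_atlas _) Xi_atlas hl.
rewrite l1 => /(_ Xi_dom) hX.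
have := @hasvel_map _ _ _ Xi c0 id _ _ _ (C1_map_id hE _) Xi_atlas (chart_at_atlas _) hX.
rewrite l1 => /(_ (chart_at_dom _)) h0.
exact: (hasvel_unique hE h0 hl).
Qed.

Hypothesis G_constricted : constricted Xi.

(** Constrictedness for the bounded set { - X }, transported from the chart Xi to
    [chart_at 1]. *)
Lemma adN_bound (X : E) p : continuous_seminorm p ->
  exists (C : R) (w : E -> R), [/\ 0 <= C, continuous_seminorm w &
    forall n Z, p (iter n (adN (G := G) X) Z) <= C ^+ n * w Z].
Proof.
move=> hp; pose T Z := dir_derive (fun u => cmap Xi (cinv c0 u)) u0 Z.
pose T' Z := dir_derive (fun u => cmap c0 (cinv Xi u)) (cmap Xi 1%g) Z.
have hv : continuous_seminorm (fun v => p (T' v)).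
  exact: (seminorm_derive hE Xi_C1_inv hp).
have [C [w [C0 hw vw H]]] := G_constricted (bounded_set1 (- X)) hv.
exists C, (fun Z => w (T Z)); split=> //; first exact: (seminorm_derive hE Xi_C1 hw).
move=> [|n] Z.
  (* constrictedness only speaks of n >= 1; for n = 0 the bound is v <= w *)
  by rewrite expr0 mul1r /= -[X in p X <= _]Xi_derivK; exact: vw.
have := H (nseq n.+1 (- X)) isT _ Z.
rewrite size_nseq !dotpE /T' Xi_derivK.
rewrite (foldr_nseq (bracket (G := G))).
by apply=> Y; rewrite mem_nseq => /andP[_ /eqP].
Qed.

Hypothesis g_complete : sequentially_complete E.

(** Each seminorm of the general term is dominated by a multiple of C^n / n!, so the
    partial sums form a Cauchy sequence. *)
Lemma ad_series_cvg (X Y : E) : convergent (ad_series (G := G) X Y @ \oo).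
Proof.
apply: g_complete => U /seminorm_nbhs[p hp pU].
have [C [w [C0 hw H]]] := adN_bound X hp.
have w0 := seminorm_ge0 Y hw.
have w1 : 0 < w Y + 1 by rewrite ltr_wpDl.
pose e := (2 * (w Y + 1))^-1.
have e0 : 0 < e by rewrite invr_gt0 mulr_gt0.
have /cvg_ex[L /= hL] := @is_cvg_series_exp_coeff R C.
have /cvgrPdist_lt/(_ e e0) [N _ hN] := hL.
have key m n : (N <= m)%N -> (m <= n)%N ->
    p (ad_series (G := G) X Y n - ad_series (G := G) X Y m) < 1.
  move=> Nm mn.
  rewrite /ad_series sub_series_geq//.
  apply: (le_lt_trans (seminorm_sum _ _ _ hp)).
  apply: (@le_lt_trans _ _ ((\sum_(m <= i < n) exp_coeff C i) * w Y)).
    rewrite mulr_suml; apply: ler_sum => i _.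
    rewrite (seminormZ _ _ hp) /exp_coeff /=.
    rewrite ger0_norm ?invr_ge0// mulrAC mulrC.
    apply: ler_pM; [exact: seminorm_ge0|by rewrite invr_ge0 ler0n|exact: H|].
    by rewrite lef_pV2 ?posrE ?ltr0n ?fact_gt0// ler_nat factS leq_pmull.
  have -> : \sum_(m <= i < n) exp_coeff C i = series (exp_coeff C) n - series (exp_coeff C) m.
    by rewrite sub_series_geq.
  have h1 := hN n (leq_trans Nm mn); have h2 := hN m Nm.
  have h3 : series (exp_coeff C) n - series (exp_coeff C) m < 2 * e.
    move: h1 h2; rewrite !ltr_norml => /andP[? ?] /andP[? ?]; lra.
  apply: (@le_lt_trans _ _ (2 * e * w Y)); first by rewrite ler_wpM2r// ltW.
  rewrite /e invfM mulrA divff// mul1r mulrC ltr_pdivrMr// mul1r.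
  by rewrite ltrDl.
exists N => m n Nm Nn; apply: pU.
have [mn|nm] := leqP m n; last by apply: key => //; exact: ltnW.
by rewrite seminormB//; exact: key.
Qed.

End Constricted.

(** * Uniform smallness of evolutions *)

Section Uniform.
Context {R : realType} {E : tvsType R} (hE : hausdorff_space E) {G : milnorLieType E}.
Implicit Types (t : R) (Y Z : E).

Notation c0 := (chart_at (1%g : G)).
Notation u0 := (cmap c0 1%g).

Variables (Xi : chart E G) (Xi_atlas : atlas Xi) (Xi_dom : cdom Xi 1%g).
Hypothesis G_constricted : constricted Xi.
Hypothesis G_continuous : infty_continuous Xi.

Variables (X : E) (nu : R -> G).
Hypothesis hnu : forall t, - 2 < t < 2 -> rvel nu t X.

Notation A := (Adc nu).
Notation B := (adN (G := G) X).

Lemma iter_curve_derive (U : set R) (F : nat -> R -> lie_algebra G) : open U ->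
  (forall i t, U t -> curve_deriv (F i) t (F i.+1 t)) ->
  forall m t, U t -> iter m curve_derive (F 0%N) t = F m t.
Proof.
move=> oU dF; elim=> [//|m IH] t Ut /=.
rewrite /curve_derive; apply: (dir_deriveP hE).
rewrite -curve_derivE; apply: curve_deriv_near (dF m t Ut).
by apply: filterS (open_nbhs_nbhs (conj oU Ut)) => s Us; rewrite IH.
Qed.

Lemma evol0 : evol 0 1 (fun=> 0 : lie_algebra G) = 1%g.
Proof.
rewrite (evolE hE (mu := fun=> 1%g)) ?mulgV//.
apply: (rvel_rlog_on hE (a := -1) (b := 2)); [by rewrite oppr_lt0|by rewrite ltr1n|].
by move=> t _; split; [exact: rvel_cst|exact: cvg_cst].
Qed.

Lemma Dinfty0 : @Dinfty R E G 0 1 (fun=> 0).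
Proof.
split; first exact: smooth_cst.
exists (fun=> 1%g); apply: (rvel_rlog_on hE (a := -1) (b := 2)).
- by rewrite oppr_lt0.
- by rewrite ltr1n.
- by move=> t _; split; [exact: rvel_cst|exact: cvg_cst].
Qed.

(** The point al(tau) is the evolution on [0, 1] of t |-> tau [Adc nu (tau t) Z].  All
    C^infty-seminorms of this curve are bounded by a seminorm of Z that does not depend
    on tau, so continuity of the evolution at the zero curve treats all tau at
    once. *)
Lemma uniform_evolution (W : set G) : nbhs (1%g : G) W ->
  exists (q : E -> R) (d : R), [/\ continuous_seminorm q, 0 < d &
  forall Z, q Z < d -> forall al : R -> G, al 0 = 1%g ->
    (forall t, - 2 < t < 2 -> rvel al t (A t Z)) ->
    forall tau, 0 <= tau <= 1 -> W (al tau)].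
Proof.
move=> W1; have := G_continuous ltr01 Dinfty0; rewrite evol0.
move=> /(_ W W1) [[[p s] e] /= [hp e0] HW].
have hT := seminorm_derive hE (Xi_C1 hE Xi_atlas Xi_dom) hp.
have [q1 hq1 q1A] := Adc_bounded hE hnu hT.
have [C [w [C0 hw HB]]] := adN_bound hE Xi_atlas Xi_dom G_constricted X hq1.
have C1 : 1 <= 1 + C by rewrite lerDl.
have Cs0 : 0 < (1 + C) ^+ s by rewrite exprn_gt0// (lt_le_trans ltr01).
exists w, (e / 2 / (1 + C) ^+ s); split=> //; first by rewrite !divr_gt0.
move=> Z; rewrite ltr_pdivlMr// => hZ al al0 hal tau tau01.
(* F i is the i-th derivative of the rescaled curve; the summand 0 gives it the
   shape of [curve_deriv_affine] and [rvel_affine] *)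
pose F (i : nat) t : E := tau ^+ i.+1 *: A (0 + tau * t) (iter i B Z).
pose U : set R := `](- 2), 2[%classic.
have oU : open U by exact: interval_open.
have Ut t : U t -> - 2 < 0 + tau * t < 2.
  rewrite /U /= in_itv /= add0r => t2; rewrite -ltr_norml.
  move: t2; rewrite -ltr_norml => t2; case/andP: tau01 => tau0 tau1.
  by rewrite normrM ger0_norm// (le_lt_trans _ t2)// ler_piMl.
have dF i t : U t -> curve_deriv (F i) t (F i.+1 t).
  move=> /Ut ht; rewrite /F (exprSr tau i.+1) -scalerA; apply: curve_derivZ.
  have h : curve_deriv (fun r => A r (iter i B Z)) (0 + tau * t)
      (A (0 + tau * t) (iter i.+1 B Z)) by exact: Adc_deriv.
  exact: (curve_deriv_affine h).
have cF i t : U t -> {for t, continuous (F i)}.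
  by move=> ht; exact: curve_deriv_cont (dF i t ht).
have sF : rlog_on 0 1 (fun t => al (0 + tau * t)) (F 0%N).
  apply: (rvel_rlog_on hE (a := - 2) (b := 2)).
  - by rewrite oppr_lt0.
  - by rewrite ltr1n.
  move=> t t2; have ht : U t by rewrite /U /= in_itv.
  split; last exact: cF.
  by rewrite /F expr1; apply: rvel_affine; apply: hal; exact: Ut.
have DF : @Dinfty R E G 0 1 (F 0%N).
  split; last by exists (fun t => al (0 + tau * t)).
  exists (- 2), 2; split; [by rewrite oppr_lt0|by rewrite ltr1n|move=> k].
  by apply: (curve_Ck hE (F := F)) => // i t _; [exact: dF|exact: cF].
have := HW (F 0%N) _ DF.
rewrite /= (evolE hE sF) mulr1 mulr0 !add0r al0 invg1 mulg1; apply.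
apply: (@le_lt_trans _ _ (e / 2)); last by rewrite ltr_pdivrMr// ltr_pMr// ltr1n.
rewrite /Cinfty_seminorm; apply: ge_sup.
  exists (dotp Xi p (iter 0 curve_derive (fun t => F 0%N t - 0 : lie_algebra G) 0)).
  by exists 0%N, 0; rewrite lexx ler01.
move=> _ [m [t [ms t01 ->]]].
have -> : (fun t => F 0%N t - 0 : lie_algebra G) = F 0%N by apply/funext => r; rewrite subr0.
have tU : U t by rewrite /U /= in_itv; exact: itv01_in.
rewrite (iter_curve_derive oU dF)// dotpE /F.
rewrite (seminormZ _ _ hT).
have /andP[tau0 tau1] := tau01; have /andP[t0 t1] := t01.
have tt01 : 0 <= 0 + tau * t <= 1.
  by rewrite add0r mulr_ge0//= -[leRHS]mulr1 ler_pM.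
have nt : `|tau ^+ m.+1| <= 1.
  by rewrite ger0_norm ?exprn_ge0// exprn_ile1.
apply: (@le_trans _ _ (1 * (C ^+ m * w Z))).
  apply: ler_pM => //; first exact: (seminorm_ge0 _ hT).
  exact: le_trans (q1A _ _ tt01) (HB m Z).
rewrite mul1r; apply: le_trans (ltW hZ); rewrite mulrC.
apply: ler_wpM2l; first exact: seminorm_ge0.
apply: (@le_trans _ _ ((1 + C) ^+ m)).
  by rewrite lerXn2r ?nnegrE ?addr_ge0// lerDr.
by rewrite ler_weXn2l.
Qed.

End Uniform.

(** * The derivative of the exponential map *)

Section Derivative.
Context {R : realType} {E : tvsType R} (hE : hausdorff_space E) {G : milnorLieType E}.
Implicit Types (t : R) (Y Z : E).

Notation c0 := (chart_at (1%g : G)).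
Notation u0 := (cmap c0 1%g).
Notation M := (chart_mul c0 c0 c0).

Variables (Xi : chart E G) (Xi_atlas : atlas Xi) (Xi_dom : cdom Xi 1%g).
Hypothesis G_constricted : constricted Xi.
Hypothesis G_continuous : infty_continuous Xi.

Variables (X : R -> E) (x : R) (X' : E) (nu : R -> R -> G) (S : E).
Hypotheses (nu0 : forall z, nu z 0 = 1%g)
  (hnu : forall z t, - 2 < t < 2 -> rvel (nu z) t (X z))
  (dX : curve_deriv X x X')
  (hS : ad_series (G := G) (X x) X' @ \oo --> S).

Notation A := (Adc (nu x)).
Notation B := (adN (G := G) (X x)).

Let al z t := ((nu x t)^-1 * nu z t)%g.

Let al0 z : al z 0 = 1%g.
Proof. by rewrite /al !nu0 invg1 mulg1. Qed.

Let rvel_al z t : - 2 < t < 2 -> rvel (al z) t (A t (X z - X x)).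
Proof. by move=> ht; exact: rvel_div (hnu x ht) (hnu z ht). Qed.

Let alx t : al x t = 1%g.
Proof. by rewrite /al mulVg. Qed.

Let al_uniform (W : set G) : nbhs (1%g : G) W ->
  \forall z \near x, forall t, 0 <= t <= 1 -> W (al z t).
Proof.
move=> W1.
have [q [d [hq d0 H]]] := uniform_evolution hE Xi_atlas Xi_dom G_constricted
  G_continuous (hnu x) W1.
have /seminorm_cvgP/(_ q hq d d0) := curve_deriv_cont dX.
by apply: filterS => z qz; apply: (H _ qz (al z)) => // t; exact: rvel_al.
Qed.

(** Let w be the coordinate of al (x + h) and S_N the N-th partial sum of the series.
    The function f(t) = h^-1 w(t) - expsum_int N t X' satisfies
    f(1) - f(0) = h^-1 (w(1) - u0) - S_N.  Its derivative is the sum of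
    om(w(t), Adc t (h^-1 (X (x + h) - X x))) - Adc t X', small for small h by
    continuity and compactness, and of a Taylor remainder, small for large N; the
    mean value inequality concludes. *)
Lemma hasvel_exp_ratio : hasvel c0 (fun z => al z 1) x S.
Proof.
split.
- by rewrite alx.
- move=> W; rewrite alx => /al_uniform.
  by apply: filterS => z; apply; rewrite ler01 lexx.
rewrite /curve_deriv alx; apply/seminorm_cvgP => p hp e e0.
have e3 : 0 < e / 3 by rewrite divr_gt0.
have [q hq qA] := Adc_bounded hE (hnu x) hp.
have [C [w [C0 hw HB]]] := adN_bound hE Xi_atlas Xi_dom G_constricted (X x) hq.
have n1 : \forall N \near \oo, p (ad_series (G := G) (X x) X' N - S) < e / 3.
  exact: (seminorm_cvgP _ _).1 hS p hp _ e3.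
have n2 : \forall N \near \oo, `|0 - w X' * (C ^+ N / N`!%:R)| < e / 3.
  have h : w X' * (C ^+ n / n`!%:R) @[n --> \oo] --> w X' * 0.
    by apply: cvgM; [exact: cvg_cst|exact: cvg_exp_coeff].
  by rewrite mulr0 in h; move/cvgrPdist_lt : h; exact.
(* N is fixed before h: the limits in N and in h are not interchanged *)
have [N [pN wN]] := filter_ex (filterI n1 n2).
have taylor t : 0 <= t <= 1 -> p (A t X' - expsum (G := G) (X x) N t X') <= e / 3.
  move=> t01; have /andP[t0 t1] := t01.
  have := @Adc_taylor _ _ hE G (X x) (nu x) (nu0 x) (hnu x) p (C ^+ N * w X') N X' hp.
  have hK r : 0 <= r <= 1 -> p (A r (iter N B X')) <= C ^+ N * w X'.
    by move=> r01; exact: le_trans (qA _ _ r01) (HB N X').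
  move=> /(_ hK t t01) h; apply: (le_trans h); apply: ltW; apply: le_lt_trans wN.
  rewrite sub0r normrN; apply: le_trans (ler_norm _).
  rewrite [w X' * _]mulrA [w X' * _]mulrC -!mulrA; apply: ler_wpM2l; first exact: exprn_ge0.
  apply: ler_wpM2l; first exact: seminorm_ge0.
  rewrite ger_pMl ?invr_gt0 ?ltr0n ?fact_gt0//; exact: exprn_ile1.
(* the velocity in the chart at a point with coordinate z and right velocity V *)
pose om (z : E) V := dir_derive M (u0, z) (V, 0).
have om_cont V : {for (u0, V), continuous (fun z : E * E => om z.1 z.2)}.
  have [M1 _] := chart_mul1_C2 (G := G) hE.
  have [_ /(_ (V, 0))[_ c]] := C1_near_at M1.
  have p1 : z.1 @[z --> (u0, V)] --> u0 by exact: cvg_fst.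
  have p2 : z.2 @[z --> (u0, V)] --> V by exact: cvg_snd.
  have q1 : (u0, z.1) @[z --> (u0, V)] --> (u0, u0) by apply: cvg_pair => //; exact: cvg_cst.
  have q2 : (z.2, 0 : E) @[z --> (u0, V)] --> (V, 0 : E) by apply: cvg_pair => //; exact: cvg_cst.
  have q3 : ((u0, z.1), (z.2, 0 : E)) @[z --> (u0, V)] --> ((u0, u0), (V, 0 : E)).
    exact: (cvg_pair q1 q2).
  exact: (cvg_at c q3).
have tube : \forall z \near (u0, X'), forall t, 0 <= t <= 1 ->
    p (om z.1 (A t z.2) - A t X') < e / 3.
  apply: (@near_itv01 R _ (nbhs (u0, X')) _ (fun z t => p (om z.1 (A t z.2) - A t X') < e / 3)) => t t01.
  have t2 := itv01_in t01.
  have pt : y.1 @[y --> (t, (u0, X'))] --> t by exact: cvg_fst.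
  have pz : y.2 @[y --> (t, (u0, X'))] --> (u0, X') by exact: cvg_snd.
  have pz1 : y.2.1 @[y --> (t, (u0, X'))] --> u0 by apply: (cvg_comp _ _ pz); exact: cvg_fst.
  have pz2 : y.2.2 @[y --> (t, (u0, X'))] --> X' by apply: (cvg_comp _ _ pz); exact: cvg_snd.
  have q1 : (y.1, y.2.2) @[y --> (t, (u0, X'))] --> (t, X').
    exact: (cvg_pair pt pz2).
  have q2 := cvg_at (Adc_continuous hE (hnu x) (Z := X') t2) q1.
  have q3 : (y.1, X') @[y --> (t, (u0, X'))] --> (t, X').
    have pc : (fun _ : R * (E * E) => X') @ nbhs (t, (u0, X')) --> X' by exact: cvg_cst.
    exact: (cvg_pair pt pc).
  have q4 := cvg_at (Adc_continuous hE (hnu x) (Z := X') t2) q3.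
  have q5 : (y.2.1, A y.1 y.2.2) @[y --> (t, (u0, X'))] --> (u0, A t X').
    exact: (cvg_pair pz1 q2).
  have q6 := cvg_at (om_cont (A t X')) q5.
  have q7 : om y.2.1 (A y.1 y.2.2) - A y.1 X' @[y --> (t, (u0, X'))] -->
      om u0 (A t X') - A t X' by exact: tvs_cvgB.
  move/seminorm_cvgP/(_ p hp _ e3) : q7.
  rewrite /om chart_mul1_l// subrr; apply: filterS => -[t' z] /=.
  by rewrite subr0.
have [[V1 V2] /= [V1u V2X] HV] := tube.
(* for small h, al (x + h) stays in the chart, with coordinates in V1 *)
have nW : nbhs (1%g : G) (cdom c0 `&` [set g | V1 (cmap c0 g)]).
  apply: filterI; first exact: cdom_nbhs.
  exact: (cmap_cont (chart_at_dom (1%g : G)) V1u).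
have n3 : \forall h \near (0 : R)^', V2 (h^-1 *: (X (x + h) - X x)) by exact: dX.
have n4 : \forall h \near (0 : R)^', forall t, 0 <= t <= 1 ->
    cdom c0 (al (x + h) t) /\ V1 (cmap c0 (al (x + h) t)).
  have := al_uniform nW => /nbhs_ballP[d /= d0 hd].
  apply/near_dnbhs0P; exists d => // h hlt _.
  by apply: hd; rewrite /ball /= opprD addrA subrr add0r normrN.
have n5 : \forall h \near (0 : R)^', h != 0 by apply/near_dnbhs0P; exists 1.
apply: filterS3 n3 n4 n5 => h hV2 hV1 h0.
pose f t := h^-1 *: cmap c0 (al (x + h) t) - expsum_int (G := G) (X x) N t X'.
pose f' t := h^-1 *: om (cmap c0 (al (x + h) t)) (A t (X (x + h) - X x))
  - expsum (G := G) (X x) N t X'.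
have df t : 0 <= t <= 1 -> curve_deriv f t (f' t).
  move=> t01; have [dal _] := hV1 t t01.
  apply: curve_derivB; last exact: expsum_int_deriv.
  apply: curve_derivZ.
  by have [_ _] := rvel_hasvel hE (chart_at_atlas _) dal (rvel_al (x + h) (itv01_in t01)).
have f'E t : 0 <= t <= 1 -> f' t =
    (om (cmap c0 (al (x + h) t)) (A t (h^-1 *: (X (x + h) - X x))) - A t X')
    + (A t X' - expsum (G := G) (X x) N t X').
  move=> t01; have [dal _] := hV1 t t01.
  rewrite addrA subrK /f'; congr (_ - _).
  have d1 : cdom c0 (1 * al (x + h) t)%g by rewrite mul1g.
  have [M1 _] := chart_mul_C2 hE (chart_at_atlas (1%g : G)) (chart_at_atlas (1%g : G))
    (chart_at_atlas (1%g : G)) (chart_at_dom _) dal d1.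
  rewrite /om /Adc AdZ// -dir_deriveZ//; last exact: C1_near_at.
  by congr (dir_derive _ _ _); congr pair; rewrite /= scaler0.
have b t : 0 <= t <= 1 -> p (f' t) <= e / 3 + e / 3.
  move=> t01; rewrite f'E//; apply: (le_trans (seminorm_triangle _ _ hp)).
  apply: lerD; last exact: taylor.
  have [_ v1] := hV1 t t01.
  exact/ltW/(HV (cmap c0 (al (x + h) t), h^-1 *: (X (x + h) - X x))).
have := @mean_value _ _ p f f' (fun t => (e / 3 + e / 3) * t) (fun=> e / 3 + e / 3) 0 1
  hp ler01 df.
rewrite mulr1 mulr0 subr0.
have dg (t : R) : 0 <= t <= 1 ->
    curve_deriv (fun t => (e / 3 + e / 3) * t : R^o) t (e / 3 + e / 3).
  move=> _; have := @curve_derivZ _ R^o (e / 3 + e / 3) _ _ _ (curve_deriv_id t).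
  by rewrite [X in curve_deriv _ _ X]mulr1.
move=> /(_ dg b).
(* al starts at the unit and expsum_int at 0 *)
have -> : f 1 - f 0 = h^-1 *: (cmap c0 (al (x + h) 1) - u0) - ad_series (G := G) (X x) X' N.
  rewrite /f al0 expsum_int0 subr0 addrAC -scalerBr; congr (_ - _).
  rewrite /expsum_int /ad_series /series /=; apply: eq_bigr => i _.
  by rewrite expr1n div1r.
move=> hfin.
apply: (@le_lt_trans _ _ ((e / 3 + e / 3) + p (ad_series (G := G) (X x) X' N - S))).
  apply: le_trans (lerD hfin (lexx _)).
  by rewrite (le_trans _ (seminorm_triangle _ _ hp))// addrA subrK.
by lra.
Qed.

End Derivative.

Theorem mainTheorem10 (R : realType) (E : tvsType R) (hE : hausdorff_space E)
    (G : milnorLieType E)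
    (Xi : chart E G) (Xi_atlas : atlas Xi) (Xi_dom : cdom Xi 1%g)
    (Xi_unit : cmap Xi 1%g = 0) (Xi_convex : convex_set (ccod Xi))
    (G_continuous : infty_continuous Xi)
    (G_semiregular : semiregular G)
    (G_constricted : constricted Xi)
    (g_complete : sequentially_complete (lie_algebra G))
    (I : set R) (I_open : open I) (I_interval : is_interval I)
    (X : R -> lie_algebra G)
    (X_C1 : Ck 1 (I : set R^o) (X : R^o -> lie_algebra G))
    (x : R) (Ix : I x) :
  let X'x := curve_derive X x in
  convergent (ad_series (X x) X'x @ \oo) /\
  has_velocity (fun z : R => lie_exp (X z)) x
    (tmap (fun h : G => (lie_exp (X x) * h)%g)
       (ad_sum (X x) X'x : tangent (1%g : G))).
Proof.
move=> X'x.
have dX : curve_deriv (X : R -> E) x X'x.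
  rewrite curve_derivE; apply/dir_derivableP => //.
  by have [d _] := X_C1; exact: (d [::]).
have conv := ad_series_cvg hE Xi_atlas Xi_dom G_constricted g_complete (X x) X'x.
split=> //.
have hS : ad_series (X x) X'x @ \oo --> ad_sum (X x) X'x.
  by case: conv => l hl; rewrite /ad_sum /limit; case: xgetP => // /(_ l).
have /choice[nu hnu] := fun z => exp_curve hE G_semiregular (X z).
have nu0 z : nu z 0 = 1%g by have [] := hnu z.
have nu1 z : nu z 1 = lie_exp (X z) by have [] := hnu z.
have rnu z t : - 2 < t < 2 -> rvel (nu z) t (X z) by have [_ _] := hnu z; exact.
have := hasvel_exp_ratio hE Xi_atlas Xi_dom G_constricted G_continuous nu0 rnu dX hS.
rewrite nu1 => hv.
have := @hasvel_map _ _ _ _ (chart_at (lie_exp (X x))) (fun k => lie_exp (X x) * k)%g _ _ _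
  (C1_map_lmul hE _ _) (chart_at_atlas _) (chart_at_atlas _) hv.
rewrite nu1 mulVKg => /(_ (chart_at_dom _)).
under eq_fun do rewrite nu1 mulVKg.
rewrite mulVg => hfin; split.
  exact: (hasvel_near_dom hfin).
have [_ _ ] := hfin; rewrite curve_derivE.
by rewrite /tmap mulg1.
Qed.
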